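(* Let $G$ be a $\Delta$-critical graph of order $n$, with maximum degree $\Delta(G)$ and minimum degree $\delta(G)$. If $\Delta(G) \geq \frac{2n+5\delta(G)-12}{3}$, then $G$ is overfull.
   Context: All graphs are finite and simple. $\chi'(G)$ is the chromatic index. $G$ is $\Delta$-critical if $\chi'(G)=\Delta(G)+1$ and $\chi'(H)<\chi'(G)$ for every proper subgraph $H$ of $G$. A graph $G$ on $n$ vertices is overfull if $|E(G)|>\Delta(G)\lfloor n/2\rfloor$. *)

(* Defs.v *)
From mathcomp Require Import all_boot.

Set Implicit Arguments.
Unset Strict Implicit.
Unset Printing Implicit Defensive.

(* The vertices form a subset of an ambient finite type T, so that a graph and
   all of its subgraphs, including those with fewer vertices, have type
   [graph T]. *)
Record graph (T : finType) := Graph {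
  vertices : {set T};
  edges : {set {set T}};
  edges_valid : [forall e in edges, (e \subset vertices) && (#|e| == 2)]
}.

Section Graphs.

Variable T : finType.
Implicit Types (G H : graph T) (v : T).

Definition graph_order G : nat := #|vertices G|.

Definition degree G v : nat := #|[set e in edges G | v \in e]|.

Definition max_degree G : nat := \max_(v in vertices G) degree G v.

(* Degrees are smaller than the order, so the default value [graph_order G] is
   returned only when G has no vertices. *)
Definition min_degree G : nat :=
  \big[minn/graph_order G]_(v in vertices G) degree G v.

(* Colourings are defined on the edges only: a colouring of all of {set T}
   could not take values in 'I_0, and an edgeless graph would get chromatic
   index 1 instead of 0. *)
Definition edge_of G := {e : {set T} | e \in edges G}.

Definition proper_edge_coloring G k (c : {ffun edge_of G -> 'I_k}) : bool :=
  [forall e : edge_of G, forall f : edge_of G,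
     (e != f) && ~~ [disjoint val e & val f] ==> (c e != c f)].

Definition edge_colorable G k : bool :=
  [exists c : {ffun edge_of G -> 'I_k}, proper_edge_coloring c].

Lemma edge_colorable_exists G : exists k, edge_colorable G k.
Proof.
exists #|{: edge_of G}|; apply/existsP; exists [ffun e => enum_rank e].
apply/forallP => e; apply/forallP => f; apply/implyP => /andP[nef _].
by rewrite !ffunE (inj_eq enum_rank_inj).
Qed.

Definition chromatic_index G : nat := ex_minn (edge_colorable_exists G).

Definition subgraph H G : bool :=
  (vertices H \subset vertices G) && (edges H \subset edges G).

Definition proper_subgraph H G : bool :=
  subgraph H G && ((vertices H != vertices G) || (edges H != edges G)).

Definition Delta_critical G : Prop :=
  chromatic_index G = (max_degree G).+1 /\
  forall H, proper_subgraph H G -> chromatic_index H < chromatic_index G.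

Definition overfull G : bool :=
  max_degree G * (graph_order G)./2 < #|edges G|.

End Graphs.

(* Main.v *)
(* Let a be a vertex of minimum degree, b a neighbour of a of degree D = Delta(G),
   and colour G - ab with D colours.  Call a colour free if it is missing at a or
   at b, and let g be the number of free colours; the edges with free colours,
   together with ab, form a graph E' that is not g-colourable, in which a has just
   two neighbours b and c, both of degree g.  Short Kempe arguments show that, in
   E', the vertices b, c, s have no common neighbour when s has degree below g, nor
   when s is adjacent to a vertex t of degree at most g - 3.  By the bound on D,
   counting common neighbours leaves no vertex of degree below g other than a; here
   Vizing's adjacency lemma provides s, and parity a second vertex of low degree.
   So no vertex except a and b misses a free colour.  Then n is odd, and a colour
   missed twice could be swapped with a free one at one of the two vertices; hence
   every colour is missed exactly once, which makes G overfull.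

   The Kempe arguments about b, c, s, t are case analyses on how alternating walks
   link these vertices; they are given as certificates for a verified checker. *)
Require Import Defs.
From mathcomp Require Import all_boot all_order all_algebra.
From mathcomp Require Import perm boolp zify.

Set Implicit Arguments.
Unset Strict Implicit.
Unset Printing Implicit Defensive.

(** Restricting to free colours leaves a, whatever its degree in G, with a single coloured edge in
    E' - ab, the edge ac; its colour [r0] is the only one missing at b. For every other colour x the
    (r0, x)-chain of a ends at b, so the chain of any other end t can be swapped without touching a,
    b or c. This freedom brings each configuration to a normal form before a certificate is applied.
    Let delta be the minimum degree, so that g = D + 2 - delta, and call a vertex other than a low
    if its degree in E' is below g, full if it is g. Counting gives 2g + deg(s) + 5 <= 2n for a low
    s, hence deg(s) <= g + 1 - 2 delta <= g - 3; for delta = 2 this is where the constant 12 is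
    needed. A full vertex next to such a low one would give 3g + 5 <= 2n, against the bound on D, so
    low vertices have only low neighbours in E'. But a neighbour s of a low v that is itself low
    misses so many colours that Vizing's lemma gives v more than delta - 2 neighbours of degree D in
    G; only delta - 2 colours are not free, so one of these is a full neighbour of v in E'. *)

Section Colorings.

(** * Colourings with one uncoloured edge: swapping, shifting, filling *)

Variables T C : finType.
Implicit Types (R E : rel T) (m : C -> T -> T) (D : pred T) (u v x y z : T) (p q r : C).

(* [m r] matches the two ends of every edge of colour [r] and fixes the
   vertices that miss [r]. *)
Definition matching m : Prop :=
  (forall r, involutive (m r)) /\
  (forall p q u, m p u = m q u -> m p u != u -> p = q).

(** Pairs with [u = v] are left out because [m r u = u] encodes a missing colour. By the second
    clause of [matching] an edge has only one colour. *)
Definition coloring R m : Prop :=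
  matching m /\ forall u v, u != v -> [exists r, m r u == v] = R u v.

Definition same_edge x y u v := (u == x) && (v == y) || (u == y) && (v == x).

Definition minus E x y : rel T := fun u v => E u v && ~~ same_edge x y u v.

Definition swap m p q D r v := if D v then m (tperm p q r) v else m r v.

Definition closed2 m p q D := forall v, D v -> D (m p v) /\ D (m q v).

Lemma closed2_compl m p q D v :
  matching m -> closed2 m p q D -> ~~ D v -> ~~ D (m p v) /\ ~~ D (m q v).
Proof.
move=> [mK _] clD Dv; split; apply: contra Dv => /clD[].
  by rewrite mK.
by rewrite mK.
Qed.

Lemma swap_id m p q D r v : r != p -> r != q -> swap m p q D r v = m r v.
Proof. by move=> rp rq; rewrite /swap tpermD // 1?eq_sym // if_same. Qed.

Lemma swapL m p q D v : D v -> swap m p q D p v = m q v.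
Proof. by rewrite /swap tpermL => ->. Qed.

Lemma swapR m p q D v : D v -> swap m p q D q v = m p v.
Proof. by rewrite /swap tpermR => ->. Qed.

Lemma swap_out m p q D r v : ~~ D v -> swap m p q D r v = m r v.
Proof. by rewrite /swap => /negPf->. Qed.

Lemma swap_coloring R m p q D :
  closed2 m p q D -> coloring R m -> coloring R (swap m p q D).
Proof.
move=> clD [Mm mR]; have [mK m_inj] := Mm; split; first split.
- move=> r v; have [-> | rp] := eqVneq r p; last have [-> | rq] := eqVneq r q.
  + have [Dv | Dv] := boolP (D v).
      by rewrite (swapL _ _ _ Dv) swapL ?mK //; case: (clD _ Dv).
    by rewrite (swap_out _ _ _ _ Dv) swap_out ?mK //; case: (closed2_compl Mm clD Dv).
  + have [Dv | Dv] := boolP (D v).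
      by rewrite (swapR _ _ _ Dv) swapR ?mK //; case: (clD _ Dv).
    by rewrite (swap_out _ _ _ _ Dv) swap_out ?mK //; case: (closed2_compl Mm clD Dv).
  + by rewrite !swap_id // mK.
- move=> r r' u; rewrite /swap; case: ifP => _ e n; last exact: m_inj e n.
  by apply: (@perm_inj _ (tperm p q)); apply: m_inj e n.
- move=> u v /mR <-; rewrite /swap; case: (D u) => //.
  apply/existsP/existsP => -[r e]; exists (tperm p q r) => //.
  by rewrite tpermK.
Qed.

(* With [m r x = x], the edge [xy] receives colour [r], which is taken away
   from the edge joining [y] to [m r y] if there is one. *)
Definition shift m r x y r' v :=
  if r' != r then m r' v else
  if v == x then y else if v == y then x else
  if v == m r y then v else m r v.

Lemma shiftN m r x y r' v : r' != r -> shift m r x y r' v = m r' v.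
Proof. by rewrite /shift => ->. Qed.

Lemma shiftx m r x y : shift m r x y r x = y.
Proof. by rewrite /shift !eqxx. Qed.

Lemma shifty m r x y : x != y -> shift m r x y r y = x.
Proof. by move=> xy; rewrite /shift eqxx /= eq_sym (negPf xy) eqxx. Qed.

Lemma shiftz m r x y :
  m r y != x -> m r y != y -> shift m r x y r (m r y) = m r y.
Proof. by move=> zx zy; rewrite /shift eqxx /= (negPf zx) (negPf zy) eqxx. Qed.

Lemma shifto m r x y v :
  v != x -> v != y -> v != m r y -> shift m r x y r v = m r v.
Proof. by move=> vx vy vz; rewrite /shift eqxx /= (negPf vx) (negPf vy) (negPf vz). Qed.

Lemma hole_uncolored E m x y r :
  coloring (minus E x y) m -> x != y -> (m r x != y) * (m r y != x).
Proof.
move=> [[mK _] mR] xy.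
have nx : m r x != y.
  apply/negP => e; have : [exists r, m r x == y] by apply/existsP; exists r.
  by rewrite mR // /minus /same_edge !eqxx andbF.
by split=> //; apply: contra nx => /eqP<-; rewrite mK.
Qed.

Lemma shift_matching E m r x y :
  coloring (minus E x y) m -> x != y -> m r x = x -> matching (shift m r x y).
Proof.
move=> mc xy mx; have nc r' := hole_uncolored r' mc xy.
have [[mK m_inj] _] := mc.
have eK v u : (m r v == u) = (v == m r u) by rewrite (can2_eq (mK r) (mK r)).
split.
  move=> r' v; have [-> | n] := eqVneq r' r; last by rewrite !shiftN // mK.
  have [-> | vx] := eqVneq v x; first by rewrite shiftx shifty.
  have [-> | vy] := eqVneq v y; first by rewrite shifty // shiftx.
  have [ez | vz] := eqVneq v (m r y).
    by rewrite ez !shiftz ?nc // -ez.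
  rewrite (shifto vx vy vz) shifto ?mK ?eK ?mx //.
  by rewrite mK.
(* At [x] and [y] the new partner is the other end of the hole, which no old colour reaches;
   elsewhere the old partner is kept or lost. *)
have S r' u : r' != r -> shift m r x y r u != u -> shift m r x y r u != m r' u.
  move=> n; have [-> _ | ux] := eqVneq u x; first by rewrite shiftx eq_sym nc.
  have [-> _ | uy] := eqVneq u y; first by rewrite shifty // eq_sym nc.
  have [ez| uz] := eqVneq u (m r y); first by rewrite ez shiftz ?nc ?eqxx // -ez.
  by rewrite shifto // => mu; apply: contra n => /eqP e; rewrite (m_inj _ _ _ e mu).
move=> p q u e n; have [ep | np] := eqVneq p r; have [eq | nq] := eqVneq q r.
- by rewrite ep eq.
- have e' : shift m r x y r u = m q u by move: e; rewrite ep (@shiftN m r x y q).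
  by move: n (S q u nq); rewrite ep => n /(_ n); rewrite e' eqxx.
- have e' : shift m r x y r u = m p u by move: e; rewrite eq (@shiftN m r x y p).
  by move: n (S p u np); rewrite e eq => n /(_ n); rewrite e' eqxx.
- by move: e n; rewrite !shiftN //; apply: m_inj.
Qed.

Lemma same_edgeC x y u v : same_edge y x u v = same_edge x y u v.
Proof. by rewrite /same_edge orbC. Qed.

Lemma shift_coloring E m r x y :
  symmetric E -> coloring (minus E x y) m -> x != y -> E x y ->
  m r x = x -> m r y != y ->
  coloring (minus E y (m r y)) (shift m r x y).
Proof.
move=> Esym mc xy Exy mx my; split; first exact: shift_matching mc xy mx.
have nc r' := hole_uncolored r' mc xy.
have [[mK m_inj] mR] := mc.
have nz : m r y != x by apply nc.
have EN u v : u != v -> [exists r', m r' u == v] = E u v && ~~ same_edge x y u v := mR u v.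
have Eyz : E y (m r y).
  have := EN y (m r y); rewrite eq_sym my => /(_ isT).
  have -> : [exists r', m r' y == m r y] by apply/existsP; exists r.
  by move/esym/andP=> [].
move=> u v uv; rewrite /minus.
have [se | nse] := boolP (same_edge x y u v).
  have -> : E u v by move: se => /orP[] /andP[/eqP-> /eqP->] //; rewrite Esym.
  have -> : same_edge y (m r y) u v = false.
    move: se => /orP[] /andP[/eqP-> /eqP->]; rewrite /same_edge.
      by rewrite (negPf xy) [x == m r y]eq_sym (negPf nz).
    by rewrite [x == m r y]eq_sym (negPf nz) (negPf xy) !andbF.
  apply/existsP; exists r.
  by move: se => /orP[] /andP[/eqP-> /eqP->]; rewrite ?shiftx ?shifty.
have [sz | nsz] := boolP (same_edge y (m r y) u v).
  rewrite andbF; apply/negbTE/existsP => -[r' /eqP].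
  have [-> | n] := eqVneq r' r.
    move: sz => /orP[] /andP[/eqP eu /eqP ev]; rewrite eu ev.
      by rewrite shifty // => e; move: nz; rewrite e eqxx.
    by rewrite shiftz // => e; move: my; rewrite e eqxx.
  rewrite shiftN // => e; case/eqP: n.
  move: sz => /orP[] /andP[/eqP eu /eqP ev]; rewrite eu ev in e.
    by apply: (m_inj _ _ y) => //; rewrite e.
  have e' : m r' y = m r y by rewrite -[RHS](mK r') e.
  by apply: (m_inj _ _ y) => //; rewrite e'.
rewrite andbT.
have <- : [exists r', m r' u == v] = E u v by rewrite EN // nse andbT.
apply/existsP/existsP => -[r']; have [-> | n] := eqVneq r' r.
- have [eu | ux] := eqVneq u x.
    by rewrite eu shiftx => /eqP ev; move: nse; rewrite /same_edge eu -ev !eqxx.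
  have [eu | uy] := eqVneq u y.
    by rewrite eu shifty // => /eqP ev; move: nse; rewrite /same_edge eu -ev !eqxx orbT.
  have [eu | uz] := eqVneq u (m r y).
    by rewrite eu shiftz // -eu (negPf uv).
  by rewrite shifto //; exists r.
- by rewrite shiftN //; exists r'.
- move=> /eqP e; exists r.
  have [eu | ux] := eqVneq u x; first by move: uv; rewrite -e eu mx eqxx.
  have [eu | uy] := eqVneq u y.
    by move: nsz; rewrite /same_edge eu -e eu !eqxx.
  have [eu | uz] := eqVneq u (m r y).
    by move: nsz; rewrite /same_edge -e eu mK !eqxx orbT.
  by rewrite shifto // e.
- by move=> e; exists r'; rewrite shiftN.
Qed.

(** [shift] serves for filling as well: when [y] also misses [r], its clause for [m r y] is masked
    by the one for [y], so no edge loses its colour. *)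
Lemma fill_coloring E m r x y :
  symmetric E -> coloring (minus E x y) m -> x != y -> E x y ->
  m r x = x -> m r y = y -> coloring E (shift m r x y).
Proof.
move=> Esym mc xy Exy mx my; split; first exact: shift_matching mc xy mx.
have nc r' := hole_uncolored r' mc xy.
have [[mK m_inj] mR] := mc.
have EN u v : u != v -> [exists r', m r' u == v] = E u v && ~~ same_edge x y u v := mR u v.
move=> u v uv; have [se | nse] := boolP (same_edge x y u v).
  have -> : E u v by move: se => /orP[] /andP[/eqP-> /eqP->] //; rewrite Esym.
  apply/existsP; exists r.
  by move: se => /orP[] /andP[/eqP-> /eqP->]; rewrite ?shiftx ?shifty.
have <- : [exists r', m r' u == v] = E u v by rewrite EN // nse andbT.
apply/existsP/existsP => -[r']; have [-> | n] := eqVneq r' r.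
- have [eu | ux] := eqVneq u x.
    by rewrite eu shiftx => /eqP ev; move: nse; rewrite /same_edge eu -ev !eqxx.
  have [eu | uy] := eqVneq u y.
    by rewrite eu shifty // => /eqP ev; move: nse; rewrite /same_edge eu -ev !eqxx orbT.
  by rewrite shifto ?my //; exists r.
- by rewrite shiftN //; exists r'.
- move=> /eqP e; exists r.
  have [eu | ux] := eqVneq u x; first by move: uv; rewrite -e eu mx eqxx.
  have [eu | uy] := eqVneq u y; first by move: uv; rewrite -e eu my eqxx.
  by rewrite shifto ?my // e.
- by move=> e; exists r'; rewrite shiftN.
Qed.

End Colorings.

(** * Kempe components and their ends *)

Section Components.

Variables T C : finType.
Implicit Types (R E : rel T) (m : C -> T -> T) (D : pred T) (u v x y z : T) (p q r c d : C).

Definition kcomp m p q x : pred T :=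
  connect (fun u v => (v == m p u) || (v == m q u)) x.

Lemma kcomp_refl m p q x : kcomp m p q x x.
Proof. exact: connect0. Qed.

Lemma kcomp_closed m p q x : closed2 m p q (kcomp m p q x).
Proof.
by move=> v xv; split; apply: connect_trans xv (connect1 _); rewrite eqxx ?orbT.
Qed.

Lemma kcomp_ind m p q x (P : T -> Prop) :
  P x -> (forall v, P v -> P (m p v) /\ P (m q v)) -> forall v, kcomp m p q x v -> P v.
Proof.
move=> Px clP v /connectP[s]; elim/last_ind: s v => [|s y IHs] v /=; first by move=> _ ->.
rewrite rcons_path last_rcons => /andP[ps /orP[] /eqP ey] ->; rewrite ey;
  by case: (clP _ (IHs _ ps erefl)).
Qed.

Lemma kcomp_sub m p q D x v : closed2 m p q D -> D x -> kcomp m p q x v -> D v.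
Proof. by move=> clD Dx; apply: (kcomp_ind (P := D) Dx clD). Qed.

Lemma kcomp_sym m p q x y : matching m -> kcomp m p q x y = kcomp m p q y x.
Proof.
move=> [mK _]; apply: sym_connect_sym => {x y} x y.
have eK r : (y == m r x) = (x == m r y) by rewrite eq_sym (can2_eq (mK r) (mK r)).
by rewrite !eK.
Qed.

Lemma kcomp_swap R m p q x :
  coloring R m -> coloring R (swap m p q (kcomp m p q x)).
Proof. by apply: swap_coloring; apply: kcomp_closed. Qed.

Fixpoint walk m c d x n :=
  if n is k.+1 then m (if odd k then d else c) (walk m c d x k) else x.

Lemma walkS m c d x k : walk m c d x k.+1 = m (if odd k then d else c) (walk m c d x k).
Proof. by []. Qed.

Lemma walkK m c d x k : matching m ->
  m (if odd k then d else c) (walk m c d x k.+1) = walk m c d x k.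
Proof. by move=> [mK _]; rewrite walkS mK. Qed.

Definition is_end m c d v := (m c v == v) != (m d v == v).

(** A step backwards along the walk leads to its previous position, and since [u] misses [d] nothing
    precedes position 0; so the walk exhausts the component. *)
Lemma comp_walk m c d u y : matching m ->
  m d u = u -> kcomp m c d u y -> exists n, walk m c d u n = y.
Proof.
move=> Mm du /connectP[s]; elim/last_ind: s y => [|s z IHs] y /=; first by move=> _ ->; exists 0.
rewrite rcons_path last_rcons => /andP[ps ez] ->.
have {IHs} [n en] := IHs _ ps erefl; rewrite -en in ez.
have nextE : exists n', walk m c d u n' = m (if odd n then d else c) (walk m c d u n).
  by exists n.+1.
have prevE : exists n', walk m c d u n' = m (if odd n then c else d) (walk m c d u n).
  case: n {en ez nextE} => [|n]; first by exists 0; rewrite /= du.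
  by exists n; rewrite -(walkK c d u n Mm) [odd n.+1]/= if_neg.
by case/orP: ez => /eqP->; move: nextE prevE; case: ifP.
Qed.

(* The component of an end [u] is a walk from [u]; it stops at the first other
   end, so it cannot contain two of them. *)
Lemma ends3 m c d u v w : matching m ->
  is_end m c d u -> is_end m c d v -> is_end m c d w -> u != v -> u != w -> v != w ->
  kcomp m c d u v -> kcomp m c d u w -> False.
Proof.
(* An end misses exactly one of the two colours; call it [d], so that the walk from [u] starts with
   [c]. *)
move=> Mm; wlog du : c d / m d u = u.
  move=> H eu ev ew uv uw vw cv cw.
  have sym x : is_end m d c x = is_end m c d x by rewrite /is_end eq_sym.
  have [/eqP du | du] := boolP (m d u == u); first exact: (H c d).
  have ks x : kcomp m c d u x -> kcomp m d c u x.
    apply: kcomp_sub (kcomp_refl _ _ _ _) => y yD.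
    by have [h1 h2] := kcomp_closed yD.
  have cu : m c u = u by move: eu; rewrite /is_end (negPf du) eqbF_neg negbK => /eqP.
  by apply: (H d c cu) => //; rewrite ?sym // ks.
move=> eu ev ew uv uw vw cv cw.
have exP : exists n, walk m c d u n \in [:: v; w].
  by have [n <-] := comp_walk Mm du cv; exists n; rewrite !inE eqxx.
have [i Pi mini] := ex_minnP exP.
pose S y := y \in [seq walk m c d u k | k <- iota 0 i.+1].
have inS k : k <= i -> S (walk m c d u k).
  by move=> ki; apply: map_f; rewrite mem_iota add0n ltnS.
have i0 : 0 < i by case: i Pi {mini S inS} => //; rewrite !inE (negPf uv) (negPf uw).
have ei : is_end m c d (walk m c d u i) by move: Pi; rewrite !inE => /orP[] /eqP->.
have wi : walk m c d u i.-1 != walk m c d u i.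
  apply/eqP => e; have := mini i.-1; rewrite e => /(_ Pi).
  by rewrite leqNgt prednK // leqnn.
(* By [wi] the colour of arrival is present at this end, so the colour that comes next is missing
   and the walk cannot leave. *)
have stop : m (if odd i then d else c) (walk m c d u i) = walk m c d u i.
  move: wi ei; rewrite -(prednK i0); set k := i.-1; rewrite succnK => wi.
  have : m (if odd k then d else c) (walk m c d u k.+1) != walk m c d u k.+1 by rewrite walkK.
  rewrite /is_end [odd k.+1]/=; move: (walk m c d u k.+1) => z.
  by case: (odd k) => /= /negPf->; rewrite ?eqbF_neg ?negbK ?[false == _]eq_sym ?eqbF_neg ?negbK => /eqP.
have clS : closed2 m c d S.
  move=> y /mapP[k]; rewrite mem_iota add0n ltnS => /= ki ->.
  have nextE : S (m (if odd k then d else c) (walk m c d u k)).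
    have [ek | ki'] := eqVneq k i; first by rewrite ek stop inS.
    by rewrite -walkS inS // ltn_neqAle ki' ki.
  have prevE : S (m (if odd k then c else d) (walk m c d u k)).
    case: k ki {nextE} => [|k] ki; first by rewrite /= du; apply: (inS 0).
    by rewrite [odd k.+1]/= if_neg walkK // inS // ltnW.
  by move: nextE prevE; case: (odd k).
have last_only x : x \in [:: v; w] -> S x -> x = walk m c d u i.
  move=> xvw /mapP[k]; rewrite mem_iota add0n ltnS /= => ki ex.
  have := mini k; rewrite -ex => /(_ xvw) ik.
  by rewrite ex; congr walk; apply/eqP; rewrite eqn_leq ki ik.
have Su : S u by apply: (inS 0).
have Sv := kcomp_sub clS Su cv; have Sw := kcomp_sub clS Su cw.
by move: vw; rewrite (last_only v) ?inE ?eqxx // (last_only w) ?inE ?eqxx ?orbT.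
Qed.

End Components.

(** * Alternating walks up to the next named vertex *)

Section FirstHit.

Variables T C : finType.
Variable K : pred T.
Implicit Types (m : C -> T -> T) (D : pred T) (x y z : T) (c d : C) (o : bool).

(* The alternating walk from [x] that starts with colour [c] first meets [K]
   at [z]; the last edge has colour [d] if [o] and [c] otherwise. *)
Definition hits m c d x z o := exists n,
  [/\ walk m c d x n.+1 = z, K z, forall i, 0 < i <= n -> ~~ K (walk m c d x i) & odd n = o].

Lemma hits_uniq m c d x z o z' o' :
  hits m c d x z o -> hits m c d x z' o' -> z = z' /\ o = o'.
Proof.
move=> [n [<- Kn un <-]] [n' [<- Kn' un' <-]].
suff -> : n = n' by [].
apply/eqP; rewrite eqn_leq; apply/andP; split; rewrite leqNgt; apply/negP => lt.
  by move/negP: (un n'.+1 lt); apply.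
by move/negP: (un' n.+1 lt); apply.
Qed.

(** Read backwards, the walk starts with its last colour, [d] if [o] and [c] otherwise; its length,
    hence the flag, is the same. *)
Lemma hits_rev m c d x z o : matching m -> K x -> hits m c d x z o ->
  hits m (if o then d else c) (if o then c else d) z x o.
Proof.
move=> Mm Kx [n [ez Kz un on]].
have rev i : i <= n.+1 ->
    walk m (if o then d else c) (if o then c else d) z i = walk m c d x (n.+1 - i).
  elim: i => [|i IHi] lei; first by rewrite subn0 ez.
  rewrite walkS IHi ?(ltnW lei) // subSS subSn // -(walkK c d x (n - i) Mm).
  by rewrite oddB // on; case: (odd i); case: (o).
exists n; split => //; first by rewrite rev // subnn.
move=> i /andP[i0 lein]; rewrite rev; last exact: leqW.
by apply: un; rewrite subn_gt0 ltnS lein leq_subLR -add1n leq_add2r.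
Qed.

Lemma hits_swap m p q D c d x z o :
  closed2 m p q D -> D x -> (c = p /\ d = q) \/ (c = q /\ d = p) ->
  hits m c d x z o -> hits (swap m p q D) d c x z o.
Proof.
move=> clD Dx cd [n [ez Kz un on]].
have same i : walk (swap m p q D) d c x i = walk m c d x i /\ D (walk m c d x i).
  elim: i => [|i [IHi Di]] //; rewrite !walkS IHi; have [Dp Dq] := clD _ Di.
  move: (walk m c d x i) Di Dp Dq => w Di Dp Dq.
  case: cd => [] [-> ->]; case: (odd i); rewrite /= ?(swapL _ _ _ Di) ?(swapR _ _ _ Di);
    by split.
exists n; split; rewrite ?(same _).1 // => i lei.
by rewrite (same i).1 un.
Qed.

(** The interior of the walk avoids [K], so a recolouring confined to named vertices can affect it
    only through its first edge. *)
Lemma hits_agree m m' c d x z o :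
  (forall v, ~~ K v -> m' c v = m c v /\ m' d v = m d v) -> m' c x = m c x ->
  hits m c d x z o -> hits m' c d x z o.
Proof.
move=> eqm eqx [n [ez Kz un on]].
have same i : i <= n.+1 -> walk m' c d x i = walk m c d x i.
  elim: i => [|[|i] IHi] lei //; rewrite walkS IHi 1?ltnW // [RHS]walkS.
  have [e1 e2] := eqm _ (un i.+1 (lei : i.+1 <= n)).
  by case: ifP => _; rewrite ?e1 ?e2.
exists n; split; rewrite ?same // => i /andP[i0 lei].
by rewrite same ?un ?i0 // leqW.
Qed.

End FirstHit.

(* What is known of a colouring with one uncoloured edge [ghole]: vertices and
   colours are numbered, [gedges] lists some coloured edges (c, (u, v)), both
   ways round, and [gmiss] lists exactly the pairs (v, c) such that v misses c.
   A fact ((v, (c, d)), o) is about the alternating walk that leaves v along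
   an edge of colour c not in [gedges]: by Some (w, o') it meets the numbered
   vertices again at w, along colour d if o' and c otherwise; by None it meets
   none of them, except for coming back to v along c. *)
Record gstate := GState {
  ghole : nat * nat;
  gedges : seq (nat * (nat * nat));
  gmiss : seq (nat * nat);
  gfacts : seq ((nat * (nat * nat)) * option (nat * bool))
}.

Definition nbrs s (c u : nat) : seq nat := [seq e.2.2 | e <- gedges s & (e.1 == c) && (e.2.1 == u)].

(* [v] has an edge of colour [c], whose other end is unknown. *)
Definition half s (v c : nat) : bool := ((v, c) \notin gmiss s) && nilp (nbrs s c v).

Definition trn (p q c : nat) : nat := if c == p then q else if c == q then p else c.

(** Certifies that [A] is the set of numbered vertices of a union of (p, q)-components: an edge that
    leaves [A] towards an unknown vertex must come with a fact saying that its walk returns to [A]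
    or meets no other numbered vertex. *)
Definition gclosed s (p q : nat) (A : seq nat) : bool :=
  all (fun e : nat * (nat * nat) =>
    ((e.1 == p) || (e.1 == q)) && (e.2.1 \in A) ==> (e.2.2 \in A)) (gedges s) &&
  all (fun u => all (fun r : nat * nat => half s u r.1 ==>
      has (fun f : (nat * (nat * nat)) * option (nat * bool) =>
        (f.1 == (u, r)) && (if f.2 is Some (w, _) then w \in A else true)) (gfacts s))
    [:: (p, q); (q, p)]) A.

(* Facts on a pair of colours that meets {p, q} in one colour survive only if the
   swapped component is entirely known. *)
Definition swap_fact s (p q : nat) (A : seq nat) (f : (nat * (nat * nat)) * option (nat * bool)) :=
  let: (v, (c, d), o) := f in
  if ((c, d) == (p, q)) || ((c, d) == (q, p)) then
    [:: if v \in A then (v, (d, c), o) else f]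
  else if [&& c \notin [:: p; q] & d \notin [:: p; q]] then [:: f]
  else if half s v c && all (fun u => ~~ half s u p && ~~ half s u q) A then [:: f]
  else [::].

Definition gswap s p q A : gstate := GState (ghole s)
  [seq (if e.2.1 \in A then trn p q e.1 else e.1, e.2) | e <- gedges s]
  [seq (u.1, if u.1 \in A then trn p q u.2 else u.2) | u <- gmiss s]
  (flatten [seq swap_fact s p q A f | f <- gfacts s]).

(** The facts kept start along an edge not listed in the old state; such an edge is not touched by
    the shift, so the rest of the walk is not either. *)
Definition gshift s x y z c := GState (y, z)
  [:: (c, (x, y)), (c, (y, x)) &
    [seq e <- gedges s | ~~ ((e.1 == c) && ((e.2 == (y, z)) || (e.2 == (z, y))))]]
  ((z, c) :: [seq u <- gmiss s | u != (x, c)])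
  [seq f <- gfacts s | half s f.1.1 f.1.2.1].

Definition gdrop s p q := GState (ghole s) (gedges s) (gmiss s)
  [seq f <- gfacts s | (f.1.2 != (p, q)) && (f.1.2 != (q, p))].

Definition gadd s fs := GState (ghole s) (gedges s) (gmiss s) (fs ++ gfacts s).

Definition gdead s (v c d : nat) := gadd s [:: ((v, (c, d)), None)].

Definition gseg s (v c d : nat) (h : nat * nat) :=
  gadd s [:: ((v, (c, d)), Some (h.1, h.2 == d));
             ((h.1, (h.2, if h.2 == d then c else d)), Some (v, h.2 == d))].

(** The possible answers, in the order in which a certificate treats them: arrivals at [h.1] along
    an unlisted edge of colour [h.2] that no known fact about the reverse walk excludes. A return to
    [v] along [c] is left to the answer [None]. *)
Definition targets n s (v c d : nat) : seq (nat * nat) :=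
  [seq h <- [seq (w, e) | w <- iota 0 n, e <- [:: minn c d; maxn c d]] |
     [&& half s h.1 h.2, h != (v, c) &
       ~~ has (fun f : (nat * (nat * nat)) * option (nat * bool) =>
         (f.1 == (h.1, (h.2, if h.2 == d then c else d))) && (f.2 != Some (v, h.2 == d)))
         (gfacts s)]].

(* A strategy leading to a colouring of the whole graph: fill the hole; shift it
   ([Shift x c]: the end x of the hole misses c); swap the colours p and q on a set
   of numbered vertices closed under the known (p, q)-walks; forget the facts on
   (p, q); or ask where the walk from v along c, then d, goes, with one
   continuation for each answer. *)
Inductive cert : Type :=
  | Fill
  | Shift of nat & nat & cert
  | Kempe of nat & nat & seq nat & cert
  | Drop of nat & nat & cert
  | Ask of nat & nat & nat & seq cert.

(** Written by hand to have an induction hypothesis for every continuation in the list of [Ask]. *)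
Fixpoint cert_ind' (P : cert -> Prop) (PFill : P Fill) (PShift : forall x c t, P t -> P (Shift x c t))
  (PKempe : forall p q B t, P t -> P (Kempe p q B t)) (PDrop : forall p q t, P t -> P (Drop p q t))
  (PAsk : forall v c d ts, foldr (fun t => and (P t)) True ts -> P (Ask v c d ts)) t : P t :=
  match t with
  | Fill => PFill
  | Shift x c t => PShift x c t (cert_ind' PFill PShift PKempe PDrop PAsk t)
  | Kempe p q B t => PKempe p q B t (cert_ind' PFill PShift PKempe PDrop PAsk t)
  | Drop p q t => PDrop p q t (cert_ind' PFill PShift PKempe PDrop PAsk t)
  | Ask v c d ts => PAsk v c d ts ((fix all (ts : seq cert) : foldr (fun t => and (P t)) True ts :=
      match ts with
      | [::] => I
      | t :: ts => conj (cert_ind' PFill PShift PKempe PDrop PAsk t) (all ts)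
      end) ts)
  end.

(** * The certificate checker *)

Section Check.

Variables n k : nat.

(** The first continuation of [Ask] is for the walk that meets nothing, the others match [targets]
    one by one; lists of different lengths are rejected. *)
Fixpoint check (t : cert) (s : gstate) : bool :=
  match t with
  | Fill => has (fun c => ((ghole s).1, c) \in gmiss s) [seq u.2 | u <- gmiss s & (u.1 == (ghole s).2) && (u.2 < k)]
  | Shift x c t =>
    let y := if x == (ghole s).1 then (ghole s).2 else (ghole s).1 in
    [&& (x == (ghole s).1) || (x == (ghole s).2), c < k, (x, c) \in gmiss s &
      if nbrs s c y is z :: _ then check t (gshift s x y z c) else false]
  | Kempe p q B t =>
    [&& p < k, q < k, p != q, all (fun u => u < n) B, gclosed s p q B & check t (gswap s p q B)]
  | Drop p q t => check t (gdrop s p q)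
  | Ask v c d ts =>
    [&& v < n, c < k, d < k, c != d, half s v c &
      if ts is t0 :: ts then check t0 (gdead s v c d) &&
        (fix go (ts : seq cert) (hs : seq (nat * nat)) := match ts, hs with
         | t :: ts', h :: hs' => check t (gseg s v c d h) && go ts' hs'
         | [::], [::] => true
         | _, _ => false
         end) ts (targets n s v c d)
      else false]
  end.

End Check.

(** * Soundness of the checker *)

Section Soundness.

Variables T C : finType.
Variables (E : rel T) (n k : nat) (pos : nat -> T) (col : nat -> C).
Hypothesis Esym : symmetric E.
Hypothesis pos_inj : {in gtn n &, injective pos}.
Hypothesis col_inj : {in gtn k &, injective col}.

Definition known : pred T := fun z => z \in [seq pos i | i <- iota 0 n].

Lemma knownP z : reflect (exists2 u, u < n & z = pos u) (known z).
Proof.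
apply: (iffP mapP) => -[u]; first by rewrite mem_iota => un ->; exists u.
by move=> un ->; exists u; rewrite ?mem_iota.
Qed.

Lemma known_pos u : u < n -> known (pos u).
Proof. by move=> un; apply/knownP; exists u. Qed.

(** A [walk] does not stop where the next colour is missing: it stays there for one step and then
    retraces its edges. A chain that ends at a vertex without a number thus appears as a return to
    [v] along [c], whence the exception in the case [None]. *)
Definition fact_holds (m : C -> T -> T) (f : (nat * (nat * nat)) * option (nat * bool)) : Prop :=
  let: (v, (c, d), w) := f in
  [/\ v < n, c < k, d < k, c != d &
   if w is Some (w, o) then w < n /\ hits known m (col c) (col d) (pos v) (pos w) o
   else forall w o, w < n -> hits known m (col c) (col d) (pos v) (pos w) o -> w = v /\ o = false].

Record realizes (s : gstate) (m : C -> T -> T) : Prop := Realizes {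
  r_hole : [/\ (ghole s).1 < n, (ghole s).2 < n, (ghole s).1 != (ghole s).2 &
               E (pos (ghole s).1) (pos (ghole s).2)];
  r_col : coloring (minus E (pos (ghole s).1) (pos (ghole s).2)) m;
  r_edge : forall c u v, (c, (u, v)) \in gedges s ->
    [/\ c < k, u < n, v < n, m (col c) (pos u) = pos v & (c, (v, u)) \in gedges s];
  r_loop : forall c u v, (c, (u, v)) \in gedges s -> u != v;
  r_miss : forall u c, u < n -> c < k -> (m (col c) (pos u) == pos u) = ((u, c) \in gmiss s);
  r_missn : forall u c, (u, c) \in gmiss s -> u < n /\ c < k;
  r_facts : forall f, f \in gfacts s -> fact_holds m f
}.

Lemma nbrsP s c u v : reflect ((c, (u, v)) \in gedges s) (v \in nbrs s c u).
Proof.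
apply: (iffP mapP) => [[[c' [u' v']]] | es].
  by rewrite mem_filter /= => /andP[/andP[/eqP-> /eqP->] ?] ->.
by exists (c, (u, v)) => //; rewrite mem_filter /= !eqxx.
Qed.

Lemma half_edge s v c w : half s v c -> (c, (v, w)) \notin gedges s.
Proof. by case/andP=> _; case En: (nbrs s c v) => // _; apply/negP=> /nbrsP; rewrite En. Qed.

Lemma not_half s m v c : realizes s m -> v < n -> c < k -> ~~ half s v c ->
  m (col c) (pos v) = pos v \/ exists2 w, w < n & m (col c) (pos v) = pos w /\ (c, (v, w)) \in gedges s.
Proof.
move=> rs vn ck; rewrite negb_and negbK => /orP[].
  by rewrite -(r_miss rs vn ck) => /eqP; left.
case En: (nbrs s c v) => [//|w l] _; right.
have /nbrsP es : w \in nbrs s c v by rewrite En mem_head.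
by exists w; have [] := r_edge rs es.
Qed.

Lemma half_moves s m v c : realizes s m -> v < n -> c < k -> half s v c ->
  m (col c) (pos v) != pos v.
Proof. by move=> rs vn ck /andP[h _]; rewrite (r_miss rs vn ck). Qed.

Lemma col_neq c d : c < k -> d < k -> c != d -> col c != col d.
Proof. by move=> ck dk; apply: contra => /eqP/col_inj->. Qed.

Lemma pos_neq u v : u < n -> v < n -> u != v -> pos u != pos v.
Proof. by move=> un vn; apply: contra => /eqP/pos_inj->. Qed.

Lemma sound_drop s m p q : realizes s m -> realizes (gdrop s p q) m.
Proof.
case=> r1 r2 r3 r3' r4 r5 r6; split=> // f; rewrite mem_filter => /andP[_]; exact: r6.
Qed.

(** If the last edge were listed or missing at [w], the vertex before [w] would be numbered, so the
    walk would be its first edge alone, which is unlisted at [v]. *)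
Lemma hits_half s m v c d w o : realizes s m -> v < n -> c < k -> d < k ->
  half s v c -> w < n -> hits known m (col c) (col d) (pos v) (pos w) o ->
  half s w (if o then d else c).
Proof.
move=> rs vn ck dk hv wn [i [ez _ un oi]]; set e := if o then d else c.
have ek : e < k by rewrite /e; case: o {oi e}.
have [[mK _] _] := r_col rs.
have ee : m (col e) (pos w) = walk m (col c) (col d) (pos v) i.
  by rewrite -ez walkS oi /e; case: (o); rewrite mK.
have first : known (m (col e) (pos w)) -> i = 0.
  rewrite ee; case: i {ee oi} ez un => // i _ un; move/negP: (un i.+1 (leqnn _)); by [].
apply/negPn/negP => /(not_half rs wn ek) [] e1; last first.
  case: e1 => w' w'n [e1 es].
  have i0 : i = 0 by apply: first; rewrite e1 known_pos.
  have ec : e = c by rewrite /e -oi i0.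
  have ev : w' = v by apply: pos_inj => //; rewrite -e1 ee i0.
  move: es; rewrite ec ev => /(r_edge rs) [_ _ _ _].
  by apply/negP; apply: half_edge.
have i0 : i = 0 by apply: first; rewrite e1 known_pos.
have ec : e = c by rewrite /e -oi i0.
have ev : w = v by apply: pos_inj => //; rewrite -e1 ee i0.
by have /eqP := half_moves rs vn ck hv; rewrite -ec -{1}ev e1 ev.
Qed.

Lemma sound_ask s m v c d :
  realizes s m -> v < n -> c < k -> d < k -> c != d -> half s v c ->
  realizes (gdead s v c d) m \/
  exists2 h, h \in targets n s v c d & realizes (gseg s v c d h) m.
Proof.
move=> rs vn ck dk cd hv; have Mm := (r_col rs).1.
have add fs : (forall f, f \in fs -> fact_holds m f) -> realizes (gadd s fs) m.
  case: rs => r1 r2 r3 r3' r4 r5 r6 H; split=> // f; rewrite mem_cat => /orP[/H //|]; exact: r6.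
pose dead := forall w o, w < n -> hits known m (col c) (col d) (pos v) (pos w) o -> w = v /\ o = false.
have [D | nD] := boolP [forall w : 'I_n, forall o : bool,
   `[< hits known m (col c) (col d) (pos v) (pos w) o >] ==> ((w : nat) == v) && ~~ o].
  left; apply: add => f; rewrite inE => /eqP->; split=> // w o wn hw.
  move/forallP: D => /(_ (Ordinal wn)) /forallP /(_ o) /implyP /= D.
  have /D /andP[/eqP-> /negPf->] // : `[< hits known m (col c) (col d) (pos v) (pos w) o >].
  exact/asboolP.
right; move: nD; rewrite negb_forall => /existsP[[w wn]]; rewrite negb_forall => /existsP[o].
rewrite negb_imply /= => /andP[/asboolP hw ne].
have hw2 := hits_half rs vn ck dk hv wn hw.
set e := if o then d else c; have eo : (e == d) = o.
  by rewrite /e; case: (o); rewrite ?eqxx // (negPf cd).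
have e'E : (if e == d then c else d) = (if o then c else d) by rewrite eo.
have hrev := hits_rev Mm (known_pos vn) hw.
have {}hrev : hits known m (col e) (col (if o then c else d)) (pos w) (pos v) o.
  by move: hrev; rewrite /e; case: (o).
have ek : e < k by rewrite /e; case: (o).
have e'k : (if o then c else d) < k by case: (o).
have ee' : e != (if o then c else d) by rewrite /e; case: (o); rewrite // eq_sym.
exists (w, e); last first.
  apply: add => f; rewrite !inE /= eo => /orP[] /eqP->; split=> //.
have memh : (w, e) \in [seq (w, e) | w <- iota 0 n, e <- [:: minn c d; maxn c d]].
  apply: allpairs_f; first by rewrite mem_iota.
  by rewrite !inE /e /minn /maxn; case: (o); case: ltnP => _; rewrite eqxx ?orbT.
rewrite mem_filter memh andbT /= hw2 e'E eo.
have wv : (w, e) != (v, c).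
  apply: contra ne => /eqP[-> ec]; rewrite eqxx /= -eo ec.
  by rewrite (negPf cd).
rewrite wv /=; apply/hasPn => -[[w1 [c1 d1]] o1] /(r_facts rs).
rewrite negb_and negbK /= => fh; case: eqP => //= -[ew ec ed]; move: fh; rewrite ew ec ed => -[_ _ _ _].
case: o1 => [[w' o'] [w'n hw']|].
  have [ep eoo] := hits_uniq hrev hw'.
  by rewrite -eoo (pos_inj _ _ ep).
move=> /(_ v o vn hrev) [evw eof]; case/eqP: wv; rewrite -evw; congr pair.
by rewrite /e eof.
Qed.

Lemma hole_sym x y (m : C -> T -> T) : coloring (minus E x y) m -> coloring (minus E y x) m.
Proof. by case=> Mm mR; split=> // u v /mR ->; rewrite /minus same_edgeC. Qed.

Lemma agree_fact m m' v c d w : fact_holds m (v, (c, d), w) -> matching m -> matching m' ->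
  (forall u, ~~ known u -> m' (col c) u = m (col c) u /\ m' (col d) u = m (col d) u) ->
  m' (col c) (pos v) = m (col c) (pos v) -> fact_holds m' (v, (c, d), w).
Proof.
move=> [vn ck dk cd fw] Mm Mm' eqm eqv; split=> //; case: w fw => [[w o] [wn hw]|dead].
  by split=> //; apply: hits_agree hw.
move=> w o wn hw; apply: dead => //; apply: hits_agree hw => // u Ku.
by have [-> ->] := eqm u Ku.
Qed.

Lemma sound_shift s m x y z c :
  realizes s m -> (ghole s = (x, y)) \/ (ghole s = (y, x)) -> c < k ->
  (x, c) \in gmiss s -> (c, (y, z)) \in gedges s ->
  realizes (gshift s x y z c) (shift m (col c) (pos x) (pos y)).
Proof.
move=> rs hxy ck xc yz.
have [xn yn xy Exy Cxy] : [/\ x < n, y < n, x != y, E (pos x) (pos y) &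
    coloring (minus E (pos x) (pos y)) m].
  have [h1 h2 h3 h4] := r_hole rs; have := r_col rs.
  case: hxy h1 h2 h3 h4 => -> /= h1 h2 h3 h4 h5; first by split.
  by split; rewrite // 1?eq_sym // 1?Esym //; apply: hole_sym.
have [_ _ zn ez zy] := r_edge rs yz.
have Pxy := pos_neq xn yn xy.
have mx : m (col c) (pos x) = pos x by apply/eqP; rewrite (r_miss rs).
have [[mK m_inj] _] := Cxy.
have my : m (col c) (pos y) != pos y by rewrite ez pos_neq // eq_sym (r_loop rs yz).
have xz : x != z.
  by apply/negP => /eqP e; have := (hole_uncolored (col c) Cxy Pxy).2; rewrite ez e eqxx.
have yz' : y != z := r_loop rs yz.
set m' := shift _ _ _ _.
have offc e u : e < k -> e != c -> m' (col e) u = m (col e) u.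
  by move=> ek ne; rewrite /m' shiftN // col_neq.
have mx' : m' (col c) (pos x) = pos y := shiftx _ _ _ _.
have my' : m' (col c) (pos y) = pos x := shifty _ _ Pxy.
have mz' : m' (col c) (pos z) = pos z.
  by rewrite -ez /m' shiftz // (hole_uncolored (col c) Cxy Pxy).2.
have oth u : u != pos x -> u != pos y -> u != pos z -> m' (col c) u = m (col c) u.
  by rewrite -ez; apply: shifto.
have Cm' : coloring (minus E (pos y) (pos z)) m'.
  by rewrite -ez; apply: shift_coloring.
have Eyz : E (pos y) (pos z).
  have := (r_col rs).2 (pos y) (pos z) (pos_neq yn zn yz').
  have -> : [exists r, m r (pos y) == pos z] by apply/existsP; exists (col c); apply/eqP.
  by move/esym/andP=> [].
rewrite /gshift; split=> //=.
- move=> e u v; rewrite !inE /= => /or3P[/eqP[-> -> ->]|/eqP[-> -> ->]|].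
  + by split; rewrite ?inE ?eqxx ?orbT.
  + by split; rewrite ?inE ?eqxx ?orbT.
  rewrite mem_filter /= => /andP[ne es]; have [ek un vn euv vu] := r_edge rs es.
  split=> //; last first.
    rewrite mem_filter /= vu andbT; apply/orP; right; apply/orP; right.
    apply: contra ne => /andP[-> /orP[] /eqP[-> ->]]; by rewrite !eqxx ?orbT.
  have [ec | nec] := eqVneq e c; last by rewrite offc.
  rewrite ec oth -?ec //.
  + apply/negP => /eqP eu; have := r_loop rs es.
    by rewrite (pos_inj un vn) ?eqxx // -euv ec eu mx.
  + apply: contra ne => /eqP eu; rewrite ec eqxx /=.
    by rewrite (pos_inj un yn eu) (pos_inj vn zn) ?eqxx // -euv eu ec.
  + apply: contra ne => /eqP eu; rewrite ec eqxx /=.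
    rewrite (pos_inj un zn eu) (pos_inj vn yn) ?eqxx ?orbT //.
    by rewrite -euv eu ec -ez mK.
- move=> e u v; rewrite !inE /= => /or3P[/eqP[_ -> ->]|/eqP[_ -> ->]|] //; first by rewrite eq_sym.
  by rewrite mem_filter => /andP[_ es]; apply: r_loop rs _ _ _ es.
- move=> u e un ek; rewrite inE mem_filter; have [ec | nec] := eqVneq e c; last first.
    by rewrite offc // (r_miss rs) // !xpair_eqE (negPf nec) !andbF.
  rewrite ec !xpair_eqE eqxx !andbT.
  have [-> | ux] := eqVneq u x.
    by rewrite mx' eq_sym (negPf Pxy) (negPf xz).
  have [-> | uy] := eqVneq u y.
    by rewrite my' (negPf Pxy) (negPf yz') /= -(r_miss rs yn ck) (negPf my).
  have [-> | uz] := eqVneq u z; first by rewrite mz' eqxx.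
  by rewrite oth ?pos_neq // (r_miss rs).
- move=> u e; rewrite inE mem_filter => /orP[/eqP[-> ->] //|/andP[_ us]]; exact: r_missn rs _ _ us.
- move=> [[v [e d]] w]; rewrite mem_filter /= => /andP[hv fs].
  have fh := r_facts rs fs; have [vn ek dk ed _] := fh.
  apply: (agree_fact fh Cxy.1 Cm'.1).
  + have un u : ~~ known u -> [&& u != pos x, u != pos y & u != pos z].
      by move=> Ku; apply/and3P; split; apply: contra Ku => /eqP->; apply: known_pos.
    move=> u /un /and3P[ux uy uz].
    by split; [have [->|] := eqVneq e c | have [->|] := eqVneq d c]; rewrite ?oth // => ?; rewrite offc.
  have [ec | nec] := eqVneq e c; last by rewrite offc.
  rewrite ec in hv *; rewrite oth // pos_neq //.
  + by apply/negP => /eqP vx; move/andP: hv => []; rewrite vx xc.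
  + by apply/negP => /eqP vy; have := half_edge z hv; rewrite vy yz.
  + by apply/negP => /eqP vz; have := half_edge y hv; rewrite vz zy.
Qed.

Section Swap.

Variables (s : gstate) (m : C -> T -> T) (p q : nat) (B : seq nat).
Hypotheses (rs : realizes s m) (pk : p < k) (qk : q < k) (pq : p != q).
Hypotheses (Bn : all (fun u => u < n) B) (clB : gclosed s p q B).

Let D : pred T := fun y => has (fun u => kcomp m (col p) (col q) (pos u) y) B.
Let m' := swap m (col p) (col q) D.

Let order r r' := (r = p /\ r' = q) \/ (r = q /\ r' = p).

Lemma closed_edge c u v : c \in [:: p; q] -> (c, (u, v)) \in gedges s -> u \in B -> v \in B.
Proof.
move=> cpq es uB; have /andP[/allP/(_ _ es) /= clE _] := clB.
by move: clE cpq; rewrite !inE uB andbT => /implyP H /H.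
Qed.

Lemma closed_hit u r r' w o : u \in B -> order r r' -> half s u r -> w < n ->
  hits known m (col r) (col r') (pos u) (pos w) o -> w \in B.
Proof.
move=> uB rr hu wn hw; have /andP[_ /allP/(_ _ uB) /allP clF] := clB.
have /clF : (r, r') \in [:: (p, q); (q, p)] by rewrite !inE; case: rr => [] [-> ->]; rewrite eqxx ?orbT.
rewrite /= hu => /hasP[[f1 [[w' o']|]] fs] /=.
  case/andP=> /eqP ef w'B; have := r_facts rs fs; rewrite ef => -[_ _ _ _ [w'n hw']].
  by have [/(pos_inj wn w'n)-> _] := hits_uniq hw hw'.
rewrite andbT => /eqP ef; have := r_facts rs fs; rewrite ef => -[_ _ _ _ dead].
by have [->] := dead _ _ wn hw.
Qed.

(** Vertices without numbers are covered by the invariant [P]: a vertex of the component is in [B],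
    or lies on a walk that left [B] by an unlisted edge and has met no numbered vertex yet. By
    [closed_hit] the first one that it meets is again in [B]. *)
Lemma known_comp u : u < n -> D (pos u) = (u \in B).
Proof.
move=> un; apply/hasP/idP => [[w wB]|uB]; last by exists u => //; apply: kcomp_refl.
pose vis y := exists v r r' i, [/\ v \in B /\ half s v r, order r r',
  walk m (col r) (col r') (pos v) i.+1 = y &
  forall j, 0 < j <= i.+1 -> ~~ known (walk m (col r) (col r') (pos v) j)].
pose P y := (exists2 v, v \in B & y = pos v) \/ vis y.
suff : kcomp m (col p) (col q) (pos w) (pos u) -> P (pos u).
  move=> H /H [[v vB /pos_inj->] //|]; first exact: (allP Bn).
  case=> v [r [r' [i [_ _ ew unk]]]]; have := unk i.+1; rewrite ew leqnn => /(_ isT).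
  by rewrite known_pos.
have Mm := (r_col rs).1.
have next v r r' i : v \in B -> half s v r -> order r r' ->
    (forall j, 0 < j <= i -> ~~ known (walk m (col r) (col r') (pos v) j)) ->
    P (walk m (col r) (col r') (pos v) i.+1).
  move=> vB hv rr unk; have [/knownP[w' w'n ew] | Ku] := boolP (known (walk m (col r) (col r') (pos v) i.+1)).
    left; exists w' => //; apply: (closed_hit vB rr hv w'n (o := odd i)).
    by exists i; split=> //; rewrite known_pos.
  right; exists v, r, r', i; split=> // j /andP[j0]; rewrite leq_eqVlt => /orP[/eqP-> //|].
  by rewrite ltnS => ji; apply: unk; rewrite j0.
have start v r r' : v \in B -> order r r' -> P (m (col r) (pos v)).
  move=> vB rr; have vn : v < n := allP Bn _ vB.
  have rk : r < k by case: rr => [] [-> _].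
  have rpq : r \in [:: p; q] by rewrite !inE; case: rr => [] [-> _]; rewrite eqxx ?orbT.
  have [hv | hv] := boolP (half s v r).
    by apply: (next v r r' 0) => // j; case: j.
  case: (not_half rs vn rk hv) => [->|[w' w'n [-> es]]]; first by left; exists v.
  by left; exists w' => //; apply: closed_edge es vB.
apply: kcomp_ind => [|y]; first by left; exists w.
case=> [[v vB ->]|[v [r [r' [i [[vB hv] rr <- unk]]]]]].
  by split; [apply: (start v p q) => //; left | apply: (start v q p) => //; right].
have fwd : P (m (if odd i.+1 then col r' else col r) (walk m (col r) (col r') (pos v) i.+1)).
  by rewrite -walkS; apply: next.
have bwd : P (m (if odd i then col r' else col r) (walk m (col r) (col r') (pos v) i.+1)).
  rewrite walkK //; case: i {fwd} unk => [|i] unk; first by left; exists v.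
  right; exists v, r, r', i; split=> // j /andP[j0 ji]; apply: unk; rewrite j0 /=; exact: leqW.
move: fwd bwd; rewrite [odd i.+1]/=.
by case: rr => [] [-> ->]; case: (odd i).
Qed.

Lemma comp_closed : closed2 m (col p) (col q) D.
Proof.
move=> v /hasP[u uB uv]; have [h1 h2] := kcomp_closed uv.
by split; apply/hasP; exists u.
Qed.

Lemma tperm_col c : c < k -> tperm (col p) (col q) (col c) = col (trn p q c).
Proof.
move=> ck; rewrite /trn; have [->|cp] := eqVneq c p; first by rewrite tpermL.
have [->|cq] := eqVneq c q; first by rewrite tpermR.
by rewrite tpermD // eq_sym col_neq.
Qed.

Lemma trnK : involutive (trn p q).
Proof.
move=> c; rewrite /trn; have [->|cp] := eqVneq c p.
  by rewrite eq_sym (negPf pq) eqxx.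
by have [->|cq] := eqVneq c q; rewrite ?eqxx // (negPf cp) (negPf cq).
Qed.

Lemma trn_lt c : c < k -> trn p q c < k.
Proof. by rewrite /trn; case: ifP => // _; case: ifP. Qed.

Lemma swap_pos u c : u < n -> c < k ->
  m' (col c) (pos u) = m (col (if u \in B then trn p q c else c)) (pos u).
Proof.
move=> un ck; rewrite /m' /swap (known_comp un); case: ifP => // _.
by rewrite tperm_col.
Qed.

Lemma sound_swap : realizes (gswap s p q B) m'.
Proof.
have clD := comp_closed; have Mm := (r_col rs).1.
have Cm' : coloring (minus E (pos (ghole s).1) (pos (ghole s).2)) m'.
  by apply: swap_coloring => //; apply: r_col.
have tr_if (b : bool) c : (if b then trn p q (if b then trn p q c else c) else (if b then trn p q c else c)) = c.
  by case: b; rewrite ?trnK.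
rewrite /gswap; split=> //=; first exact: (r_hole rs).
- move=> c u v /mapP[[c' [u' v']] es /= [-> -> ->]]; have [c'k un vn euv vu] := r_edge rs es.
  have ck : (if u' \in B then trn p q c' else c') < k by case: ifP => // _; apply: trn_lt.
  split=> //; first by rewrite swap_pos // tr_if.
  apply/mapP; exists (c', (v', u')) => //=; congr (_, _).
  have [cpq | ncpq] := boolP (c' \in [:: p; q]).
    suff -> : (v' \in B) = (u' \in B) by [].
    by apply/idP/idP; apply: closed_edge cpq _; rewrite ?es.
  by move: ncpq; rewrite /trn !inE negb_or => /andP[/negPf-> /negPf->]; rewrite !if_same.
- by move=> c u v /mapP[[c' [u' v']] es /= [_ -> ->]]; apply: r_loop rs _ _ _ es.
- move=> u c un ck; rewrite swap_pos // (r_miss rs) //; last by case: ifP => // _; apply: trn_lt.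
  apply/idP/mapP => [h|[[u' c'] us /= [-> ->]]]; last by rewrite tr_if.
  by exists (u, if u \in B then trn p q c else c) => //=; rewrite tr_if.
- move=> u c /mapP[[u' c'] us /= [-> ->]]; have [un ck] := r_missn rs us.
  by split=> //; case: ifP => // _; apply: trn_lt.
- move=> f /flattenP[fs' /mapP[[[v [c d]] w] fs ->]]; have fh := r_facts rs fs.
  have [vn ck dk cd fw] := fh.
  rewrite /swap_fact; case: ifP => [epq|_].
    rewrite inE => /eqP->.
    have ord : (col c = col p /\ col d = col q) \/ (col c = col q /\ col d = col p).
      by case/orP: epq => /eqP[-> ->]; [left|right].
    have [vB|vB] := ifP.
      have Dv : D (pos v) by rewrite known_comp.
      have ord' : (col d = col p /\ col c = col q) \/ (col d = col q /\ col c = col p).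
        by case: ord => [] [-> ->]; [right|left].
      split=> //; first by rewrite eq_sym.
      case: w {fh fs} fw => [[w o] [wn hw]|dead]; first by split=> //; apply: hits_swap hw.
      move=> w o wn hw; apply: (dead _ _ wn).
      (* Swapping [m'] once more on [D] gives [m] back, so a walk of [m'] becomes a walk of [m], to
         which [dead] applies. *)
      have clD' : closed2 m' (col p) (col q) D.
        by move=> y Dy; rewrite /m' (swapL _ _ _ Dy) (swapR _ _ _ Dy); case: (clD _ Dy).
      have [i [e1 e2 e3 e4]] := hits_swap clD' Dv ord' hw.
      have mE r y : swap m' (col p) (col q) D r y = m r y.
        by rewrite /m' /swap; case: (D y); rewrite ?tpermK.
      have wE j : walk (swap m' (col p) (col q) D) (col c) (col d) (pos v) j = walk m (col c) (col d) (pos v) j.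
        by elim: j => //= j ->; rewrite mE.
      by exists i; split; rewrite -?wE // => j /e3; rewrite wE.
    have Dv : ~~ D (pos v) by rewrite known_comp // vB.
    have wE j : walk m' (col c) (col d) (pos v) j = walk m (col c) (col d) (pos v) j /\
                ~~ D (walk m (col c) (col d) (pos v) j).
      elim: j => //= j [->]; move: (walk _ _ _ _ j) => y nD; rewrite /m' swap_out //; split=> //.
      have [h1 h2] := closed2_compl Mm clD nD.
      by case: ord => [] [-> ->]; case: ifP.
    have hE z o : hits known m' (col c) (col d) (pos v) z o <-> hits known m (col c) (col d) (pos v) z o.
      split=> -[i [e1 e2 e3 e4]]; exists i; split=> //.
      - by rewrite -e1 (wE i.+1).1.
      - by move=> j /e3; rewrite (wE j).1.
      - by rewrite -e1 (wE i.+1).1.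
      - by move=> j /e3; rewrite (wE j).1.
    split=> //; case: w {fh fs} fw => [[w o] [wn hw]|dead]; first by split=> //; apply/hE.
    by move=> w o wn /hE; apply: dead.
  have out r : r < k -> r \notin [:: p; q] -> forall y, m' (col r) y = m (col r) y.
    by move=> rk; rewrite !inE negb_or => /andP[rp rq] y; rewrite /m' swap_id ?col_neq.
  case: ifP => [/andP[cn dn]|_].
    rewrite inE => /eqP->; apply: (agree_fact fh Mm Cm'.1); last exact: out.
    by move=> y _; rewrite !out.
  case: ifP => // /andP[hv /allP nhB]; rewrite inE => /eqP->.
  (* No vertex of [B] has an unlisted edge of colour [p] or [q], so the whole swapped set consists
     of numbered vertices. *)
  have inB y : D y -> known y.
    case/hasP=> u uB uy; suff [w' w'B ->] : exists2 w', w' \in B & y = pos w'.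
      exact: known_pos (allP Bn _ w'B).
    move: y uy; apply: kcomp_ind => [|y [w' w'B ->]]; first by exists u.
    have w'n : w' < n := allP Bn _ w'B; have /andP[np nq] := nhB _ w'B.
    split; [have := not_half rs w'n pk np | have := not_half rs w'n qk nq];
      case=> [->|[w2 w2n [-> es]]]; try (by exists w'); exists w2 => //;
      by apply: closed_edge es w'B; rewrite !inE eqxx ?orbT.
  apply: (agree_fact fh Mm Cm'.1) => [y Ky|].
    by rewrite /m' !swap_out //; apply: contra Ky; apply: inB.
  have [vB|vB] := boolP (v \in B); last first.
    by rewrite /m' swap_out // known_comp.
  have /andP[np nq] := nhB _ vB.
  apply: out => //; rewrite !inE negb_or; apply/andP; split.
    by apply: contraNneq np => <-.
  by apply: contraNneq nq => <-.
Qed.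

End Swap.

Hypothesis nocol : forall m : C -> T -> T, ~ coloring E m.

Lemma check_sound t s m : check n k t s -> realizes s m -> False.
Proof.
elim/cert_ind': t s m => [s m | x c t IHt s m | p q B t IHt s m | p q t IHt s m | v c d ts IHts s m] /=.
- case/hasP=> c /mapP[[u c'] /=]; rewrite mem_filter /= => /andP[/andP[/eqP-> ck] h2] -> h1 rs.
  have [n1 n2 n12 e12] := r_hole rs.
  apply: nocol; apply: (@fill_coloring _ _ E m (col c')) e12 _ _ => //; first exact: r_col rs.
  + exact: pos_neq.
  + by apply/eqP; rewrite (r_miss rs).
  + by apply/eqP; rewrite (r_miss rs).
- move=> /and4P[hx ck xc]; case En: (nbrs _ _ _) => [//|z l] ct rs.
  have /nbrsP es : z \in nbrs s c (if x == (ghole s).1 then (ghole s).2 else (ghole s).1).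
    by rewrite En mem_head.
  apply: IHt ct _; apply: sound_shift rs _ ck xc es.
  case: (ghole s) hx {En} => h1 h2 /= /orP[] /eqP->; first by rewrite eqxx; left.
  by case: eqP => [->|_]; [left|right].
- by case/and5P=> pk qk pq Bn /andP[clB ct] rs; apply: IHt ct (sound_swap rs pk qk pq Bn clB).
- by move=> ct rs; apply: IHt ct (sound_drop p q rs).
case/and5P=> vn ck dk cd /andP[hv]; case: ts IHts => [//|t ts] [IHt IHts] /andP[ct cts] rs.
case: (sound_ask rs vn ck dk cd hv) => [|[h]]; first exact: IHt ct.
elim: ts (targets n s v c d) IHts cts => [|t' ts IH] [|h' hs] //= [IHt' IHts] /andP[ct' cts].
rewrite inE => /orP[/eqP-> rh|hh rh]; first exact: IHt' ct' rh.
exact: (IH hs IHts cts hh rh).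
Qed.

End Soundness.

(* Found by computer search.  In cert_core, cert_core2, cert_core3 the vertices are
   a, b, c, w, s; in cert_tail1, cert_tail they are a, b, c, w, s, t; in cert_path
   they are a, b, c, s, t. *)
Definition cert_core : cert :=
  Ask 2 2 0 [:: Kempe 0 2 [:: 0; 2] (Fill); Ask 4 2 0 [:: Kempe 0 2 [:: 4] (Drop 0 2 (Ask 1 3 2
  [:: Ask 2 2 3 [:: Ask 4 3 2 [:: Ask 1 1 0 [:: Kempe 0 1 [:: 1] (Fill); Kempe 0 1 [:: 0; 1; 2]
  (Kempe 1 2 [:: 1; 3; 4] (Fill)); Shift 1 0 (Shift 0 3 (Kempe 2 3 [:: 4] (Kempe 1 3 [:: 3; 4]
  (Kempe 0 1 [:: 0; 1; 3] (Fill))))); Shift 0 2 (Kempe 1 2 [:: 3; 4] (Kempe 0 1 [:: 1; 4]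
  (Fill)))]]; Ask 1 1 0 [:: Kempe 0 1 [:: 1] (Fill); Kempe 0 1 [:: 0; 1; 2] (Kempe 1 2 [:: 1; 3;
  4] (Fill)); Shift 1 0 (Shift 0 3 (Kempe 2 3 [:: 1; 3] (Kempe 1 2 [:: 3; 4] (Kempe 0 1 [:: 0;
  1; 3] (Fill))))); Shift 0 2 (Kempe 1 2 [:: 3; 4] (Kempe 0 1 [:: 1; 4] (Fill)))]]; Ask 4 3 2
  [:: Ask 1 1 0 [:: Kempe 0 1 [:: 1] (Fill); Kempe 0 1 [:: 0; 1; 2] (Kempe 1 2 [:: 1; 3; 4]
  (Fill)); Shift 1 0 (Shift 0 3 (Kempe 2 3 [:: 4] (Kempe 1 3 [:: 3; 4] (Kempe 0 1 [:: 0; 1; 3]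
  (Fill))))); Shift 0 2 (Kempe 1 2 [:: 3; 4] (Kempe 0 1 [:: 1; 4] (Fill)))]]; Ask 2 2 3 [::
  Shift 0 2 (Kempe 2 3 [:: 2; 3] (Drop 2 3 (Ask 1 3 0 [:: Kempe 0 3 [:: 1] (Fill); Kempe 0 3 [::
  0; 1; 2] (Fill); Kempe 0 3 [:: 1; 3] (Kempe 2 3 [:: 0; 1] (Kempe 0 2 [:: 0; 2; 3] (Fill)));
  Ask 2 3 0 [:: Kempe 0 3 [:: 0; 2] (Kempe 0 2 [:: 0; 1] (Kempe 2 3 [:: 0; 2; 3] (Fill))); Kempe
  0 3 [:: 0; 2; 3] (Fill); Kempe 0 3 [:: 0; 1; 2; 4] (Fill)]; Ask 2 3 0 [:: Kempe 0 3 [:: 0; 2]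
  (Kempe 0 2 [:: 0; 1] (Kempe 2 3 [:: 0; 2; 3] (Fill))); Kempe 0 3 [:: 0; 2; 3] (Fill); Kempe 0
  3 [:: 0; 1; 2; 4] (Fill)]])))]]))]; Kempe 0 2 [:: 0; 2; 4] (Fill)].

Definition cert_core2 : cert :=
  Ask 1 1 0 [:: Kempe 0 1 [:: 1] (Fill); Kempe 0 1 [:: 0; 1; 2] (Kempe 1 2 [:: 1; 3; 4] (Fill));
  Kempe 0 1 [:: 1; 3; 4] (Fill)].

Definition cert_core3 : cert :=
  Ask 1 1 0 [:: Kempe 0 1 [:: 1] (Fill); Kempe 0 1 [:: 0; 1; 2] (Kempe 1 3 [:: 0; 2; 3; 4]
  (Fill)); Kempe 0 1 [:: 1; 3; 4] (Fill)].

Definition cert_tail1 : cert :=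
  Ask 2 2 0 [:: Kempe 0 2 [:: 0; 2] (Fill); Ask 4 2 0 [:: Kempe 0 2 [:: 4; 5] (Drop 0 2 (Ask 1 3
  2 [:: Ask 2 2 3 [:: Ask 4 3 2 [:: Ask 1 1 0 [:: Kempe 0 1 [:: 1] (Fill); Kempe 0 1 [:: 0; 1;
  2] (Kempe 1 2 [:: 1; 3; 4; 5] (Fill)); Shift 1 0 (Shift 0 3 (Kempe 2 3 [:: 4; 5] (Kempe 1 3
  [:: 3; 4; 5] (Kempe 0 1 [:: 0; 1; 3] (Fill))))); Shift 0 2 (Kempe 1 2 [:: 3; 4; 5] (Kempe 0 1
  [:: 1; 4; 5] (Fill)))]]; Ask 1 1 0 [:: Kempe 0 1 [:: 1] (Fill); Kempe 0 1 [:: 0; 1; 2] (Kempe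
  1 2 [:: 1; 3; 4; 5] (Fill)); Shift 1 0 (Shift 0 3 (Kempe 2 3 [:: 1; 3] (Kempe 1 2 [:: 3; 4; 5]
  (Kempe 0 1 [:: 0; 1; 3] (Fill))))); Shift 0 2 (Kempe 1 2 [:: 3; 4; 5] (Kempe 0 1 [:: 1; 4; 5]
  (Fill)))]]; Ask 4 3 2 [:: Ask 1 1 0 [:: Kempe 0 1 [:: 1] (Fill); Kempe 0 1 [:: 0; 1; 2] (Kempe
  1 2 [:: 1; 3; 4; 5] (Fill)); Shift 1 0 (Shift 0 3 (Kempe 2 3 [:: 4; 5] (Kempe 1 3 [:: 3; 4; 5]
  (Kempe 0 1 [:: 0; 1; 3] (Fill))))); Shift 0 2 (Kempe 1 2 [:: 3; 4; 5] (Kempe 0 1 [:: 1; 4; 5]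
  (Fill)))]]; Ask 2 2 3 [:: Shift 0 2 (Kempe 2 3 [:: 2; 3] (Drop 2 3 (Ask 1 3 0 [:: Kempe 0 3
  [:: 1] (Fill); Kempe 0 3 [:: 0; 1; 2] (Fill); Kempe 0 3 [:: 1; 3] (Kempe 2 3 [:: 0; 1] (Kempe
  0 2 [:: 0; 2; 3] (Fill))); Ask 2 3 0 [:: Kempe 0 3 [:: 0; 2] (Kempe 0 2 [:: 0; 1] (Kempe 2 3
  [:: 0; 2; 3] (Fill))); Kempe 0 3 [:: 0; 2; 3] (Fill); Kempe 0 3 [:: 0; 1; 2; 4] (Fill)]; Ask 2
  3 0 [:: Kempe 0 3 [:: 0; 2] (Kempe 0 2 [:: 0; 1] (Kempe 2 3 [:: 0; 2; 3] (Fill))); Kempe 0 3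
  [:: 0; 2; 3] (Fill); Kempe 0 3 [:: 0; 1; 2; 4] (Fill)]])))]]))]; Kempe 0 2 [:: 0; 2; 4; 5]
  (Fill)].

Definition cert_tail : cert :=
  Ask 2 2 0 [:: Kempe 0 2 [:: 0; 2] (Fill); Ask 4 2 0 [:: Kempe 0 2 [:: 4; 5] (Drop 0 2 (Ask 1 1
  0 [:: Kempe 0 1 [:: 1] (Fill); Ask 4 0 1 [:: Shift 0 2 (Kempe 0 1 [:: 0; 1; 2] (Shift 1 1
  (Shift 3 2 (Kempe 0 1 [:: 4] (Fill))))); Kempe 0 1 [:: 3; 4] (Kempe 0 2 [:: 1; 3; 4; 5]
  (Fill)); Ask 3 0 1 [:: Kempe 0 1 [:: 3; 4; 5] (Drop 0 1 (Ask 1 3 0 [:: Kempe 0 3 [:: 1]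
  (Fill); Kempe 0 3 [:: 0; 1; 2; 3; 4] (Kempe 2 3 [:: 1; 3; 4; 5] (Fill)); Kempe 0 3 [:: 1; 5]
  (Fill)]))]]; Ask 2 1 0 [:: Kempe 0 1 [:: 0; 2] (Fill); Ask 5 1 0 [:: Ask 1 3 2 [:: Shift 1 0
  (Shift 0 3 (Kempe 2 3 [:: 1; 3] (Kempe 0 1 [:: 5] (Kempe 1 2 [:: 3; 4; 5] (Kempe 0 1 [:: 2; 4;
  5] (Fill)))))); Shift 1 0 (Shift 0 3 (Kempe 2 3 [:: 0; 1; 2; 3] (Kempe 0 1 [:: 5] (Kempe 1 2
  [:: 3; 4; 5] (Kempe 0 1 [:: 2; 4; 5] (Fill)))))); Ask 2 2 3 [:: Shift 0 2 (Kempe 2 3 [:: 2; 3]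
  (Drop 2 3 (Drop 0 1 (Ask 1 3 0 [:: Kempe 0 3 [:: 1] (Fill); Kempe 0 3 [:: 0; 1; 2] (Fill);
  Kempe 0 3 [:: 1; 3] (Kempe 2 3 [:: 0; 1] (Kempe 0 2 [:: 0; 2; 3] (Fill))); Ask 2 3 0 [:: Kempe
  0 3 [:: 0; 2] (Kempe 0 2 [:: 0; 1] (Kempe 2 3 [:: 0; 2; 3] (Fill))); Kempe 0 3 [:: 0; 2; 3]
  (Fill); Kempe 0 3 [:: 0; 1; 2; 4] (Fill)]; Ask 2 3 0 [:: Kempe 0 3 [:: 0; 2] (Kempe 0 2 [:: 0;
  1] (Kempe 2 3 [:: 0; 2; 3] (Fill))); Kempe 0 3 [:: 0; 2; 3] (Fill); Kempe 0 3 [:: 0; 1; 2; 4]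
  (Fill)]]))))]]]; Kempe 0 1 [:: 0; 2; 5] (Fill)]; Ask 2 1 0 [:: Kempe 0 1 [:: 0; 2] (Fill);
  Shift 0 2 (Kempe 0 1 [:: 0; 1; 2; 3; 4] (Kempe 0 2 [:: 3; 4; 5] (Kempe 0 1 [:: 0; 2; 3]
  (Fill)))); Kempe 0 1 [:: 0; 2; 5] (Fill)]; Kempe 0 1 [:: 1; 5] (Fill)]))]; Kempe 0 2 [:: 0; 2;
  4; 5] (Fill)].

Definition cert_path : cert :=
  Ask 1 2 0 [:: Kempe 0 2 [:: 1] (Fill); Kempe 0 2 [:: 0; 1; 2] (Kempe 1 2 [:: 1; 3; 4] (Fill));
  Kempe 0 2 [:: 1; 3; 4] (Fill)].

Section GameContra.

Variables (T C : finType) (E : rel T).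
Hypothesis Esym : symmetric E.
Hypothesis nocol : forall m : C -> T -> T, ~ coloring E m.

Definition both_ways (es : seq (nat * (nat * nat))) :=
  es ++ [seq (e.1, (e.2.2, e.2.1)) | e <- es].

(** The list [gm] must be complete, because [half] takes an absent pair as a colour that is present.
    Hence the case distinctions, before an application, on the colours missing at s or t. *)
Lemma game_contra x0 r0 (ns : seq T) (cs : seq C) h es gm t m :
  let pos := nth x0 ns in let col := nth r0 cs in
  uniq ns -> uniq cs ->
  coloring (minus E (pos h.1) (pos h.2)) m -> E (pos h.1) (pos h.2) ->
  all (fun e : nat * (nat * nat) => m (col e.1) (pos e.2.1) == pos e.2.2) es ->
  all (fun u => all (fun c => (m (col c) (pos u) == pos u) == ((u, c) \in gm)) (iota 0 (size cs)))
    (iota 0 (size ns)) ->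
  [&& h.1 < size ns, h.2 < size ns, h.1 != h.2,
    all (fun e : nat * (nat * nat) =>
      [&& e.1 < size cs, e.2.1 < size ns, e.2.2 < size ns & e.2.1 != e.2.2]) es,
    all (fun u : nat * nat => (u.1 < size ns) && (u.2 < size cs)) gm &
    check (size ns) (size cs) t (GState h (both_ways es) gm [::])] -> False.
Proof.
move=> pos col /(uniqP x0) uns /(uniqP r0) ucs Cm Eh /allP mes /allP mgm.
case/and5P=> h1 h2 h12 /allP wes /andP[/allP wgm ct].
apply: (check_sound Esym uns ucs nocol ct (m := m)); split=> //=.
- have [[mK _] _] := Cm.
  move=> c u v; rewrite mem_cat => /orP[ein|/mapP[[c' [u' v']] ein [-> -> ->]]].
    have /and4P[/= ck un vn uv] := wes _ ein.
    split=> //; first exact/eqP/(mes _ ein).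
    by rewrite mem_cat (map_f (fun e => (e.1, (e.2.2, e.2.1))) ein) orbT.
  have /and4P[/= ck un vn uv] := wes _ ein.
  have /eqP /= euv := mes _ ein.
  split=> //; last by rewrite mem_cat ein.
  exact: etrans (congr1 _ (esym euv)) (mK _ _).
- move=> c u v; rewrite mem_cat => /orP[ein|/mapP[[c' [u' v']] ein [_ -> ->]]].
    by have /and4P[] := wes _ ein.
  by have /and4P[_ _ _] := wes _ ein; rewrite eq_sym.
- move=> u c un ck; have /mgm/allP mgmu : u \in iota 0 (size ns) by rewrite mem_iota.
  by have /mgmu/eqP : c \in iota 0 (size cs) by rewrite mem_iota.
- by move=> u c /wgm /andP[].
Qed.

End GameContra.

(** * Degrees and numbers of missing colours *)

Section Degrees.

Variables (T C : finType) (E : rel T).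
Hypothesis Esym : symmetric E.
Hypothesis Eirr : irreflexive E.

Definition deg v := #|[set u | E v u]|.

Definition miss (m : C -> T -> T) v := [set r | m r v == v].

Lemma card_miss (R : rel T) m v :
  irreflexive R -> coloring R m -> #|miss m v| + #|[set u | R v u]| = #|C|.
Proof.
move=> Rirr [[_ m_inj] mR].
have -> : [set u | R v u] = [set m r v | r in ~: miss m v].
  apply/setP => u; rewrite inE; apply/idP/imsetP.
    have [<-|vu] := eqVneq v u; first by rewrite Rirr.
    rewrite -mR // => /existsP[r /eqP e]; exists r => //.
    by rewrite !inE e eq_sym.
  by case=> r; rewrite !inE eq_sym => mr ->; rewrite -mR //; apply/existsP; exists r.
rewrite card_in_imset ?cardsC //.
by move=> r r'; rewrite !inE => mr _ e; apply: m_inj e mr.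
Qed.

Lemma minus_irr x y : irreflexive (minus E x y).
Proof. by move=> v; rewrite /minus Eirr. Qed.

Lemma card_miss_out x y m v : coloring (minus E x y) m -> v != x -> v != y ->
  #|miss m v| + deg v = #|C|.
Proof.
move=> Cm vx vy; rewrite -(card_miss v (@minus_irr x y) Cm); congr (_ + #|pred_of_set _|).
by apply/setP => u; rewrite !inE /minus /same_edge (negPf vx) (negPf vy) andbT.
Qed.

Lemma card_miss_end x y m : coloring (minus E x y) m -> E x y ->
  #|miss m x| + deg x = #|C|.+1.
Proof.
move=> Cm Exy; rewrite -(card_miss x (@minus_irr x y) Cm) /deg -addnS; congr (_ + _).
have xy : x != y by apply: contraTneq Exy => ->; rewrite Eirr.
rewrite (cardsD1 y) inE Exy add1n; congr _.+1; apply: eq_card => u.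
by rewrite !inE /minus /same_edge eqxx (negPf xy) /= orbF andbC.
Qed.

End Degrees.

(** * Kempe arguments around a vertex a with the two neighbours b and c *)

Section TwoNeighbours.

Variables (T C : finType) (E : rel T).
Hypothesis Esym : symmetric E.
Hypothesis Eirr : irreflexive E.
Hypothesis nocol : forall m : C -> T -> T, ~ coloring E m.

Variables a b c : T.
Hypotheses (Eab : E a b) (Eac : E a c) (bc : b != c).
Hypothesis Ea : forall v, E a v -> v = b \/ v = c.
Hypothesis degb : deg E b = #|C|.

Lemma adj_neq u v : E u v -> u != v.
Proof. by apply: contraTneq => ->; rewrite Eirr. Qed.

Let ab : a != b := adj_neq Eab.
Let ac : a != c := adj_neq Eac.

Implicit Types (m : C -> T -> T) (r p q : C).

Definition special m r0 :=
  [/\ m r0 a = c, forall r, (m r a == a) = (r != r0) & forall r, (m r b == b) = (r == r0)].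

Lemma colored_adj R m r v : coloring R m -> m r v != v -> R v (m r v).
Proof.
by move=> [_ mR] mv; rewrite -mR 1?eq_sym //; apply/existsP; exists r.
Qed.

Lemma adj_colored m u v : coloring (minus E a b) m -> E u v -> ~~ same_edge a b u v ->
  exists r, m r u = v.
Proof.
move=> Cm Euv ns; have : minus E a b u v by rewrite /minus Euv ns.
by rewrite -Cm.2 ?adj_neq // => /existsP[r /eqP]; exists r.
Qed.

Lemma no_fill m : coloring (minus E a b) m -> forall r, m r a = a -> m r b = b -> False.
Proof. by move=> Cm r ra rb; apply: nocol; apply: fill_coloring Cm ab Eab ra rb. Qed.

(** The only coloured edge at a is ac, and [r0] is its colour. As b has full degree and one
    uncoloured edge, it misses one colour; a cannot miss it too, so it is [r0]. *)
Lemma specialP m : coloring (minus E a b) m -> exists r0, special m r0.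
Proof.
move=> Cm; have [r0 r0a] : exists r, m r a = c.
  apply: (adj_colored Cm Eac); rewrite /same_edge eqxx /= eq_sym (negPf bc) /=.
  by rewrite negb_and ab.
have ra r : (m r a == a) = (r != r0).
  have [->|nr] := eqVneq r r0; first by rewrite r0a eq_sym (negPf ac).
  apply/negPn/negP => mra; have := colored_adj Cm mra.
  move=> /andP[/Ea [] e].
    by rewrite /same_edge e !eqxx.
  by move: nr; rewrite (Cm.1.2 r r0 a) ?eqxx // r0a.
exists r0; split=> //.
have cm : #|miss m b| = 1.
  have := card_miss_end Eirr (hole_sym Cm); rewrite Esym Eab degb => /(_ isT).
  by rewrite -add1n => /eqP; rewrite eqn_add2r => /eqP.
have sub : miss m b \subset [set r0].
  apply/subsetP => r; rewrite !inE => rb; apply/negPn/negP; rewrite -ra => rA.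
  by apply: (no_fill Cm (r := r)); apply/eqP.
have e : miss m b = [set r0] by apply/eqP; rewrite eqEcard sub cards1 cm.
by move=> r; have := in_set1 r r0; rewrite -e inE.
Qed.

(* The (r0, x)-component of the hole's ends is a path from [a] to [b]. *)
Lemma end_apart m r0 x t : coloring (minus E a b) m -> special m r0 -> x != r0 ->
  t != a -> t != b -> is_end m r0 x t ->
  ~~ kcomp m r0 x t a /\ ~~ kcomp m r0 x t b.
Proof.
move=> Cm [r0a ra rb] xr ta tb et; have Mm := Cm.1.
have ea : is_end m r0 x a by rewrite /is_end !ra eqxx xr.
have eb : is_end m r0 x b by rewrite /is_end !rb eqxx (negPf xr).
have cab : kcomp m r0 x a b.
  apply/negPn/negP => nab; apply: (no_fill (kcomp_swap r0 x a Cm) (r := r0)).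
    by rewrite swapL ?kcomp_refl //; apply/eqP; rewrite ra.
  by rewrite swap_out //; apply/eqP; rewrite rb.
have nat : ~~ kcomp m r0 x a t.
  by apply/negP => cat; apply: (ends3 Mm ea eb et) cab cat; rewrite // eq_sym.
have nta : ~~ kcomp m r0 x t a by rewrite kcomp_sym.
split=> //; apply: contra nta => ctb; apply: connect_trans ctb _.
by have := cab; rewrite kcomp_sym.
Qed.

(** The swapped component avoids a and b by [end_apart], and then also c, which is joined to a by
    [r0]. *)
Lemma toggle m r0 x t : coloring (minus E a b) m -> special m r0 -> x != r0 ->
  t \notin [:: a; b; c] -> is_end m r0 x t ->
  exists m', [/\ coloring (minus E a b) m', special m' r0,
    forall r v, v \in [:: a; b; c] -> m' r v = m r v,
    forall r, m' r t = m (tperm r0 x r) t & #|miss m' t| = #|miss m t|].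
Proof.
move=> Cm sp xr; rewrite !inE !negb_or => /and3P[ta tb tc] et.
have [na nb] := end_apart Cm sp xr ta tb et.
have [r0a ra rb] := sp.
have nc : ~~ kcomp m r0 x t c.
  by have [] := closed2_compl Cm.1 (kcomp_closed (m := m) (p := r0) (q := x) (x := t)) na; rewrite r0a.
have keep r v : v \in [:: a; b; c] -> swap m r0 x (kcomp m r0 x t) r v = m r v.
  by rewrite !inE => /or3P[] /eqP->; apply: swap_out.
have m't r : swap m r0 x (kcomp m r0 x t) r t = m (tperm r0 x r) t by rewrite /swap kcomp_refl.
exists (swap m r0 x (kcomp m r0 x t)); split=> //; first exact: kcomp_swap.
  by split=> [|r|r]; rewrite keep ?inE ?eqxx ?orbT.
rewrite -[RHS](card_imset _ (@perm_inj _ (tperm r0 x))); apply: eq_card => r.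
rewrite inE m't; apply/idP/imsetP => [h|[q]]; first by exists (tperm r0 x r); rewrite ?inE ?tpermK.
by rewrite inE => h ->; rewrite tpermK.
Qed.

(** Otherwise {a, c} is a whole (r0, r)-component; after its swap a misses [r0], as b does. *)
Lemma miss0_c m r0 : coloring (minus E a b) m -> special m r0 -> forall r, m r c != c.
Proof.
move=> Cm sp r; apply/negP => rc; have [r0a ra rb] := sp.
have r0c : m r0 c = a by rewrite -r0a Cm.1.1.
have rr : r != r0 by apply: contraTneq rc => ->; rewrite r0c.
apply: (game_contra Esym nocol (x0 := a) (r0 := r0) (ns := [:: a; b; c]) (cs := [:: r0; r])
  (h := (0, 1)) (es := [:: (0, (0, 2))]) (gm := [:: (0, 1); (1, 0); (2, 1)])
  (t := Kempe 0 1 [:: 0; 2] Fill) (m := m)) => //=.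
- by rewrite !inE negb_or ab ac bc.
- by rewrite !inE eq_sym rr.
- by rewrite r0a eqxx.
- by rewrite !ra !rb rc r0c (negPf ac) eqxx rr (negPf rr).
Qed.

Lemma ex_miss_special m r0 t : coloring (minus E a b) m -> special m r0 -> t \notin [:: a; b; c] ->
  miss m t != set0 -> exists m', [/\ coloring (minus E a b) m', special m' r0 & m' r0 t = t].
Proof.
move=> Cm sp tabc /set0Pn[x]; rewrite inE => /eqP xt.
have [r0t|r0t] := eqVneq (m r0 t) t; first by exists m.
have xr : x != r0 by apply: contraNneq r0t => <-; rewrite xt.
have et : is_end m r0 x t by rewrite /is_end (negPf r0t) xt eqxx.
have [m' [Cm' sp' keep m't _]] := toggle Cm sp xr tabc et.
by exists m'; split; rewrite // m't tpermL xt.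
Qed.

Lemma pick2 (A : {set C}) x y : 2 < #|A| -> exists z, [/\ z \in A, z != x & z != y].
Proof.
move=> A2; have /set0Pn[z] : A :\ x :\ y != set0.
  rewrite -card_gt0; have := cardsD1 x A; have := cardsD1 y (A :\ x).
  by case: (_ \in _); case: (_ \in _) => /= e1 e2; move: A2; rewrite e2 e1; case: #|_|.
by rewrite !inE => /and3P[zy zx zA]; exists z.
Qed.

(** First [r0] is made missing at t. A toggle with [q] then trades [r0] for [q], and a third missing
    colour [z], different from [r0] and [al], is spent to get [r0] back. This is why t must miss
    three colours. *)
Lemma put_missing m r0 t q al : coloring (minus E a b) m -> special m r0 -> t \notin [:: a; b; c] ->
  2 < #|miss m t| -> q != r0 ->
  exists m', [/\ coloring (minus E a b) m', special m' r0,
    forall r v, v \in [:: a; b; c] -> m' r v = m r v,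
    2 < #|miss m' t| & [/\ m' r0 t = t, m' q t = t & m al t = t -> m' al t = t]].
Proof.
move=> Cm sp tabc c3 qr.
have [m1 [Cm1 sp1 keep1 c1 [r01 al1]]] : exists m1, [/\ coloring (minus E a b) m1, special m1 r0,
    forall r v, v \in [:: a; b; c] -> m1 r v = m r v, 2 < #|miss m1 t| &
    m1 r0 t = t /\ (m al t = t -> m1 al t = t)].
  have [r0t|r0t] := eqVneq (m r0 t) t; first by exists m.
  have [z [zt zal _]] := pick2 al al c3; rewrite inE in zt; move/eqP: zt => zt.
  have zr : z != r0 by apply: contraNneq r0t => <-; rewrite zt.
  have et : is_end m r0 z t by rewrite /is_end (negPf r0t) zt eqxx.
  have [m' [Cm' sp' keep m't cd]] := toggle Cm sp zr tabc et.
  exists m'; split; rewrite ?cd //; split; first by rewrite m't tpermL zt.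
  move=> alt; rewrite m't tpermD //.
  by apply: contraNneq r0t => ->; rewrite alt.
have [qt|qt] := eqVneq (m1 q t) t; first by exists m1.
have eq : is_end m1 r0 q t by rewrite /is_end (negPf qt) r01 eqxx.
have [m2 [Cm2 sp2 keep2 m2t cd2]] := toggle Cm1 sp1 qr tabc eq.
have [z [zt zr zal]] := pick2 r0 al c1; rewrite inE in zt; move/eqP: zt => zt.
have zq : z != q by apply: contraNneq qt => <-; rewrite zt.
have m2z : m2 z t = t by rewrite m2t tpermD // eq_sym.
have m2r0 : m2 r0 t != t by rewrite m2t tpermL.
have ez : is_end m2 r0 z t by rewrite /is_end (negPf m2r0) m2z eqxx.
have [m3 [Cm3 sp3 keep3 m3t cd3]] := toggle Cm2 sp2 zr tabc ez.
exists m3; split; rewrite ?cd3 ?cd2 //; first by move=> r v h; rewrite keep3 // keep2 // keep1.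
have m3r0 : m3 r0 t = t by rewrite m3t tpermL m2z.
split=> //; first by rewrite m3t tpermD // 1?eq_sym // m2t tpermR.
move=> /al1 alt; have [->//|alr] := eqVneq al r0.
have alq : al != q by apply: contraNneq qt => <-; rewrite alt.
by rewrite m3t tpermD // 1?eq_sym // m2t tpermD // eq_sym.
Qed.

Hypothesis excol : exists m : C -> T -> T, coloring (minus E a b) m.

Lemma deg_c : deg E c = #|C|.
Proof.
have [m Cm] := excol; have [r0 sp] := specialP Cm.
rewrite -(card_miss_out Eirr Cm (v := c)) 1?eq_sym //.
suff -> : miss m c = set0 by rewrite cards0.
by apply/setP => r; rewrite !inE (negPf (miss0_c Cm sp r)).
Qed.

Lemma adj_b m r0 u : coloring (minus E a b) m -> special m r0 -> E b u -> u != a ->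
  exists2 p, p != r0 & m p b = u.
Proof.
move=> Cm [r0a ra rb] Ebu ua; have [|p pb] := adj_colored Cm Ebu.
  by rewrite /same_edge (negPf ua) andbF orbF eq_sym (negPf ab).
exists p => //; apply: contraTneq (adj_neq Ebu) => e.
by rewrite negbK -pb e eq_sym rb.
Qed.

(** If u missed a colour, it could be made to miss [r0]. The colour of bu is missing at a, so it can
    be moved to ab; the new hole bu has [r0] missing at both ends. *)
Lemma deg_adj_b u : E b u -> u != a -> deg E u = #|C|.
Proof.
move=> Ebu ua; have [->|uc] := eqVneq u c; first exact: deg_c.
have [m Cm] := excol; have [r0 sp] := specialP Cm.
have ub : u != b by rewrite eq_sym adj_neq.
rewrite -(card_miss_out Eirr Cm (v := u)) //.
suff -> : miss m u = set0 by rewrite cards0.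
apply/eqP/negPn/negP => nz.
have uabc : u \notin [:: a; b; c] by rewrite !inE !negb_or ua ub.
have {m Cm sp nz} [m [Cm sp r0u]] := ex_miss_special Cm sp uabc nz.
have [p pr pb] := adj_b Cm sp Ebu ua; have [r0a ra rb] := sp.
have pu : m p u = b by rewrite -pb Cm.1.1.
apply: (game_contra Esym nocol (x0 := a) (r0 := r0) (ns := [:: a; b; u]) (cs := [:: r0; p])
  (h := (0, 1)) (es := [:: (1, (1, 2))]) (gm := [:: (0, 1); (1, 0); (2, 0)])
  (t := Shift 0 1 Fill) (m := m)) => //=.
- by rewrite !inE negb_or ab eq_sym ua eq_sym ub.
- by rewrite !inE eq_sym pr.
- by rewrite pb eqxx.
- by rewrite !ra !rb r0u pu !eqxx (negPf pr) [b == _]eq_sym (negPf ub).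
Qed.

Lemma sees_all m u : coloring (minus E a b) m -> u != a -> u != b -> deg E u = #|C| ->
  forall r, (m r u == u) = false.
Proof.
move=> Cm ua ub du r; have := card_miss_out Eirr Cm ua ub; rewrite du -[RHS]add0n => /eqP.
by rewrite eqn_add2r cards_eq0 => /eqP/setP/(_ r); rewrite !inE.
Qed.

(** Let t miss [r0] and the colour [al] of bs, and let [g] be the colour of st. If the (r0, g)-chain
    of b avoids a, its swap makes [g] missing at both a and b. Otherwise, after its swap b misses
    [g], the path b, s, t is a whole (al, g)-component, and swapping it frees [al] at b. *)
Lemma no_low_path s t : E b s -> s != a -> s != c -> E s t -> t \notin [:: a; b; c] ->
  deg E t + 3 <= #|C| -> False.
Proof.
move=> Ebs sa sc Est tabc dt; have [m Cm] := excol; have [r0 sp] := specialP Cm.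
have sb : s != b by rewrite eq_sym adj_neq.
have := tabc; rewrite !inE !negb_or => /and3P[ta tb tc].
have [al alr alb] := adj_b Cm sp Ebs sa.
have c3 : 2 < #|miss m t|.
  by rewrite -(leq_add2r (deg E t)) (card_miss_out Eirr Cm ta tb) addnC.
have [m' [Cm' sp' keep _ [r0t alt _]]] := put_missing al Cm sp tabc c3 alr.
have {keep} alb' : m' al b = s by rewrite keep ?alb // !inE eqxx orbT.
have als' : m' al s = b by rewrite -alb' Cm'.1.1.
have [g gs] : exists g, m' g s = t.
  by apply: (adj_colored Cm' Est); rewrite /same_edge (negPf sa) (negPf sb).
have gt : m' g t = s by rewrite -gs Cm'.1.1.
have st : s != t := adj_neq Est.
have gr : g != r0 by apply: contraNneq st => e; rewrite -[X in X == _]gt e r0t.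
have gal : g != al by apply: contraNneq st => e; rewrite -[X in X == _]gt e alt.
have [r0a ra rb] := sp'.
have cE r := negPf (miss0_c Cm' sp' r).
have sE := sees_all Cm' sa sb (deg_adj_b Ebs sa).
apply: (game_contra Esym nocol (x0 := a) (r0 := r0) (ns := [:: a; b; c; s; t])
  (cs := [:: r0; al; g]) (h := (0, 1)) (es := [:: (0, (0, 2)); (1, (1, 3)); (2, (3, 4))])
  (gm := [:: (0, 1); (0, 2); (1, 0); (4, 0); (4, 1)]) (t := cert_path) (m := m')) => //=.
- by rewrite !inE !negb_or ab ac bc st ![a == _]eq_sym ![b == _]eq_sym ![c == _]eq_sym sa ta sb tb sc tc.
- by rewrite !inE !negb_or ![r0 == _]eq_sym alr gr eq_sym gal.
- by rewrite r0a alb' gs !eqxx.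
- by rewrite !ra !rb !cE !sE r0t alt gt !eqxx (negPf st) (negPf alr) (negPf gr).
Qed.

(** Let s miss [r0], and let [p1], [p2], [p3] be the colours of ws, wb, wc. If the (r0, p1)-chain of
    b avoids a, its swap allows filling. Otherwise, after the swap b misses [p1]; if s misses [p2],
    the path b, w, s is a component that can be swapped to free [p2] at b, and if s misses [p3], the
    path a, c, w, s is one whose swap frees [p1] at a. The longest certificate is for the case that
    s misses neither. *)
Lemma no_low_common_nbr w s : E w b -> E w c -> E w s -> w != a -> s \notin [:: a; b; c] ->
  deg E s < #|C| -> False.
Proof.
move=> Ewb Ewc Ews wa sabc ds; have [m0 Cm0] := excol; have [r0 sp0] := specialP Cm0.
have := sabc; rewrite !inE !negb_or => /and3P[sa sb sc].
have nz : miss m0 s != set0.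
  apply: contraTneq ds => e; have := card_miss_out Eirr Cm0 sa sb.
  by rewrite e cards0 add0n => ->; rewrite ltnn.
have {m0 Cm0 sp0 nz} [m [Cm sp r0s]] := ex_miss_special Cm0 sp0 sabc nz.
have [wb wc ws] : [/\ w != b, w != c & w != s] by split; apply: adj_neq.
have [p2 p2r p2b] : exists2 p, p != r0 & m p b = w by apply: adj_b Cm sp _ wa; rewrite Esym.
have [p3 p3c] : exists p, m p c = w.
  by apply: (adj_colored Cm); rewrite 1?Esym // /same_edge ![c == _]eq_sym (negPf ac) (negPf bc).
have [p1 p1s] : exists p, m p s = w.
  by apply: (adj_colored Cm); rewrite 1?Esym // /same_edge (negPf sa) (negPf sb).
have [r0a ra rb] := sp.
have r0c : m r0 c = a by rewrite -r0a Cm.1.1.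
have p3r : p3 != r0 by apply: contraNneq wa => e; rewrite -p3c e r0c.
have p1r : p1 != r0 by apply: contraNneq ws => e; rewrite -p1s e r0s.
have [p1w p2w p3w] : [/\ m p1 w = s, m p2 w = b & m p3 w = c].
  by rewrite -{1}p1s -{1}p2b -{1}p3c !Cm.1.1.
have p12 : p1 != p2 by apply: contraNneq sb => e; rewrite -p1w e p2w.
have p13 : p1 != p3 by apply: contraNneq sc => e; rewrite -p1w e p3w.
have p23 : p2 != p3 by apply: contraNneq bc => e; rewrite -p2w e p3w.
have cE r := negPf (miss0_c Cm sp r).
have wE := sees_all Cm wa wb (deg_adj_b (eq_trans (Esym b w) Ewb) wa).
have Un : uniq [:: a; b; c; w; s].
  by rewrite /= !inE !negb_or ab ac bc ws ![a == _]eq_sym ![b == _]eq_sym ![c == _]eq_sym wa sa wb sb wc sc.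
have Uc : uniq [:: r0; p1; p2; p3].
  by rewrite /= !inE !negb_or ![r0 == _]eq_sym p1r p2r p3r p12 p13 p23.
have game := game_contra Esym nocol (x0 := a) (r0 := r0) (h := (0, 1)) (m := m) Un Uc Cm Eab
  (es := [:: (0, (0, 2)); (2, (1, 3)); (3, (2, 3)); (1, (4, 3))]).
have edges_ok : [&& m r0 a == c, m p2 b == w, m p3 c == w, m p1 s == w & true].
  by rewrite r0a p2b p3c p1s !eqxx.
have p1sE : (m p1 s == s) = false by rewrite p1s (negPf ws).
have [e2|e2] := boolP (m p2 s == s); have [e3|e3] := boolP (m p3 s == s).
- apply: (game [:: (0, 1); (0, 2); (0, 3); (1, 0); (4, 0); (4, 2); (4, 3)] cert_core3) => //=.
  by rewrite !ra !rb !cE !wE r0s e2 e3 p1sE !eqxx (negPf p1r) (negPf p2r) (negPf p3r).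
- apply: (game [:: (0, 1); (0, 2); (0, 3); (1, 0); (4, 0); (4, 2)] cert_core2) => //=.
  by rewrite !ra !rb !cE !wE r0s e2 (negPf e3) p1sE !eqxx (negPf p1r) (negPf p2r) (negPf p3r).
- apply: (game [:: (0, 1); (0, 2); (0, 3); (1, 0); (4, 0); (4, 3)] cert_core3) => //=.
  by rewrite !ra !rb !cE !wE r0s (negPf e2) e3 p1sE !eqxx (negPf p1r) (negPf p2r) (negPf p3r).
- apply: (game [:: (0, 1); (0, 2); (0, 3); (1, 0); (4, 0)] cert_core) => //=.
  by rewrite !ra !rb !cE !wE r0s (negPf e2) (negPf e3) p1sE !eqxx (negPf p1r) (negPf p2r) (negPf p3r).
Qed.

(** The edge st of colour [r0] replaces a missing [r0] at s: a chain in [r0] and [p2] or [p3] that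
    arrives at s goes on to t and ends there. This need not hold for the colour [p1] of ws, hence
    the two certificates. *)
Lemma tail_contra m r0 p2 p3 w s t : coloring (minus E a b) m -> special m r0 ->
  m p2 b = w -> m p3 c = w -> E w s -> m r0 s = t -> m p2 t = t -> m p3 t = t -> s != t ->
  w != a -> s \notin [:: a; b; c] -> t \notin [:: a; b; c] -> w != t -> deg E s = #|C| ->
  False.
Proof.
move=> Cm sp p2b p3c Ews r0s p2t p3t st wa sabc tabc wt ds.
have := sabc; have := tabc; rewrite !inE !negb_or => /and3P[ta tb tc] /and3P[sa sb sc].
have ws : w != s := adj_neq Ews.
have [r0a ra rb] := sp.
have r0c : m r0 c = a by rewrite -r0a Cm.1.1.
have r0t : m r0 t = s by rewrite -r0s Cm.1.1.
have [p1 p1s] : exists p, m p s = w.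
  by apply: (adj_colored Cm); rewrite 1?Esym // /same_edge (negPf sa) (negPf sb).
have p3r : p3 != r0 by apply: contraNneq wa => e; rewrite -p3c e r0c.
have p2r : p2 != r0 by apply: contraNneq st => e; rewrite -[X in X == _]r0t -e p2t.
have p1r : p1 != r0 by apply: contraNneq wt => e; rewrite -p1s e r0s.
have [p1w p2w p3w] : [/\ m p1 w = s, m p2 w = b & m p3 w = c].
  by rewrite -{1}p1s -{1}p2b -{1}p3c !Cm.1.1.
have p12 : p1 != p2 by apply: contraNneq sb => e; rewrite -p1w e p2w.
have p13 : p1 != p3 by apply: contraNneq sc => e; rewrite -p1w e p3w.
have p23 : p2 != p3 by apply: contraNneq bc => e; rewrite -p2w e p3w.
have wb : w != b by apply: contraNneq p2r => e; rewrite -rb p2b e.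
have wc : w != c by have /negP := miss0_c Cm sp p3; rewrite p3c => /negP.
have Ebw : E b w.
  have := colored_adj Cm (r := p2) (v := b); rewrite p2b => /(_ wb) /andP[]; by [].
have cE r := negPf (miss0_c Cm sp r).
have wE := sees_all Cm wa wb (deg_adj_b Ebw wa).
have sE := sees_all Cm sa sb ds.
have Un : uniq [:: a; b; c; w; s; t].
  rewrite /= !inE !negb_or ab ac bc ws wt st ![a == _]eq_sym ![b == _]eq_sym ![c == _]eq_sym.
  by rewrite wa sa ta wb sb tb wc sc tc.
have Uc : uniq [:: r0; p1; p2; p3].
  by rewrite /= !inE !negb_or ![r0 == _]eq_sym p1r p2r p3r p12 p13 p23.
have game := game_contra Esym nocol (x0 := a) (r0 := r0) (h := (0, 1)) (m := m) Un Uc Cm Eab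
  (es := [:: (0, (0, 2)); (2, (1, 3)); (3, (2, 3)); (1, (4, 3)); (0, (4, 5))]).
have edges_ok : [&& m r0 a == c, m p2 b == w, m p3 c == w, m p1 s == w, m r0 s == t & true].
  by rewrite r0a p2b p3c p1s r0s !eqxx.
have [e1|e1] := boolP (m p1 t == t).
- apply: (game [:: (0, 1); (0, 2); (0, 3); (1, 0); (5, 1); (5, 2); (5, 3)] cert_tail1) => //=.
  by rewrite !ra !rb !cE !wE !sE r0t p2t p3t e1 !eqxx (negPf st) (negPf p1r) (negPf p2r) (negPf p3r).
- apply: (game [:: (0, 1); (0, 2); (0, 3); (1, 0); (5, 2); (5, 3)] cert_tail) => //=.
  by rewrite !ra !rb !cE !wE !sE r0t p2t p3t (negPf e1) !eqxx (negPf st) (negPf p1r) (negPf p2r) (negPf p3r).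
Qed.

(** Gives ab the colour [r0] of ac, so that b and c exchange their roles. *)
Lemma shift_hole m r0 : coloring (minus E a b) m -> special m r0 ->
  coloring (minus E a c) (shift m r0 b a).
Proof.
move=> Cm [r0a ra rb]; rewrite -[in X in minus E a X]r0a.
apply: (shift_coloring Esym (hole_sym Cm)).
- by rewrite eq_sym.
- by rewrite Esym.
- by apply/eqP; rewrite rb.
- by rewrite ra eqxx.
Qed.

End TwoNeighbours.

(** * Exchanging b and c; counting common neighbours *)

Section BothNeighbours.

Variables (T C : finType) (E : rel T).
Hypothesis Esym : symmetric E.
Hypothesis Eirr : irreflexive E.
Hypothesis nocol : forall m : C -> T -> T, ~ coloring E m.

Variables a b c : T.
Hypotheses (Eab : E a b) (Eac : E a c) (bc : b != c).
Hypothesis Ea : forall v, E a v -> v = b \/ v = c.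
Hypothesis degb : deg E b = #|C|.
Hypothesis excol : exists m : C -> T -> T, coloring (minus E a b) m.

Let cb : c != b. Proof. by rewrite eq_sym. Qed.
Let Ea' v : E a v -> v = c \/ v = b. Proof. by move=> /Ea []; [right|left]. Qed.
Let degc : deg E c = #|C|. Proof. exact: (deg_c Esym Eirr nocol Eab Eac bc Ea degb excol). Qed.

Lemma excol_c : exists m : C -> T -> T, coloring (minus E a c) m.
Proof.
have [m Cm] := excol; have [r0 sp] := specialP Esym Eirr nocol Eab Eac bc Ea degb Cm.
by exists (shift m r0 b a); apply: shift_hole.
Qed.

Lemma deg_adj_c u : E c u -> u != a -> deg E u = #|C|.
Proof. exact: (deg_adj_b Esym Eirr nocol Eac Eab cb Ea' degc excol_c). Qed.

Let deg_adj_b u : E b u -> u != a -> deg E u = #|C|.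
Proof. exact: (deg_adj_b Esym Eirr nocol Eab Eac bc Ea degb excol). Qed.

Lemma no_low_path_b s t : E b s -> s != a -> E s t -> t \notin [:: a; b; c] -> deg E t + 3 <= #|C| -> False.
Proof.
move=> Ebs sa Est tabc dt; have [e|sc] := eqVneq s c; last first.
  exact: (no_low_path Esym Eirr nocol Eab Eac bc Ea degb excol Ebs sa sc Est tabc dt).
move: tabc dt; rewrite !inE !negb_or => /and3P[ta _ _].
by rewrite deg_adj_c -?e // -[X in _ <= X]addn0 leq_add2l.
Qed.

Lemma no_low_path_c s t : E c s -> s != a -> E s t -> t \notin [:: a; b; c] -> deg E t + 3 <= #|C| -> False.
Proof.
move=> Ecs sa Est tabc dt; have [e|sb] := eqVneq s b; last first.
  apply: (no_low_path Esym Eirr nocol Eac Eab cb Ea' degc excol_c Ecs sa sb Est) dt.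
  by move: tabc; rewrite !inE !negb_or => /and3P[-> -> ->].
move: tabc dt; rewrite !inE !negb_or => /and3P[ta _ _].
by rewrite deg_adj_b -?e // -[X in _ <= X]addn0 leq_add2l.
Qed.

Lemma no_common_nbr_next_low w s t : E w b -> E w c -> E w s -> E s t -> w != a ->
  s \notin [:: a; b; c] -> t \notin [:: a; b; c] -> deg E s = #|C| -> deg E t + 3 <= #|C| -> False.
Proof.
move=> Ewb Ewc Ews Est wa sabc tabc ds dt; have [m Cm] := excol.
have := sabc; have := tabc; rewrite !inE !negb_or => /and3P[ta tb tc] /and3P[sa sb sc].
have [r0 sp] := specialP Esym Eirr nocol Eab Eac bc Ea degb Cm.
have wt : w != t.
  apply: contraTneq dt => e; rewrite -e deg_adj_b 1?Esym // -[X in _ <= X]addn0 leq_add2l.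
  by [].
have c3 : 2 < #|miss m t|.
  by rewrite -(leq_add2r (deg E t)) (card_miss_out Eirr Cm ta tb) addnC.
have [al alr alb] := adj_b Eirr Eab Cm sp (eq_trans (Esym b w) Ewb) wa.
have [m1 [Cm1 sp1 keep1 c31 [r0t1 alt1 _]]] := put_missing Esym Eirr nocol Eab al Cm sp tabc c3 alr.
have [ab ac] : a != b /\ a != c by split; apply: adj_neq Eirr _ _ _.
have {keep1} alb1 : m1 al b = w by rewrite keep1 // !inE eqxx orbT.
have [r0a1 _ _] := sp1.
(* So far t misses [r0] and the colour [al] of wb. With the hole at ac the vertex c takes the place
   of b, and [put_missing] adds the colour of wc while keeping [al]. *)
pose m2 := shift m1 r0 b a.
have Cm2 : coloring (minus E a c) m2 := shift_hole Esym Eirr Eab Cm1 sp1.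
have sp2 : special a c b m2 r0.
  have [r sp2] := specialP Esym Eirr nocol Eac Eab cb Ea' degc Cm2.
  suff -> : r0 = r by [].
  have [ra _ _] := sp2; apply: (Cm2.1.2 _ _ a); rewrite /m2 shifty 1?eq_sym //.
have m2t r : m2 r t = m1 r t.
  have [->|rr] := eqVneq r r0; last by rewrite /m2 shiftN.
  by rewrite /m2 shifto // r0a1.
have alb2 : m2 al b = w by rewrite /m2 shiftN.
have c32 : 2 < #|miss m2 t|.
  by rewrite (_ : miss m2 t = miss m1 t) //; apply/setP => r; rewrite !inE m2t.
have tacb : t \notin [:: a; c; b] by rewrite !inE !negb_or ta tb tc.
have sacb : s \notin [:: a; c; b] by rewrite !inE !negb_or sa sb sc.
have [al' alr' alc] := adj_b Eirr Eac Cm2 sp2 (eq_trans (Esym c w) Ewc) wa.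
have [m3 [Cm3 sp3 keep3 _ [r0t alt' al3]]] := put_missing Esym Eirr nocol Eac al Cm2 sp2 tacb c32 alr'.
have {al3} alt : m3 al t = t by apply: al3; rewrite m2t.
have st : s != t := adj_neq Eirr Est.
have [g gs] : exists g, m3 g s = t.
  by apply: (adj_colored Eirr Cm3 Est); rewrite /same_edge (negPf sa) (negPf sc).
have gt : m3 g t = s by rewrite -gs Cm3.1.1.
have notg r : m3 r t = t -> r != g.
  by move=> rt; apply: contraNneq st => e; rewrite -[X in X == _]gt -e rt.
have gr : g != r0 by rewrite eq_sym notg.
(* Toggling [r0] with the colour [g] of st gives this edge the colour [r0], as [tail_contra]
   demands; the other colours at t stay. *)
have eg : is_end m3 r0 g t by rewrite /is_end r0t gt eqxx (negPf st).
have [m4 [Cm4 sp4 keep4 m4t _]] := toggle Esym Eirr nocol Eac Cm3 sp3 gr tacb eg.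
have r0s : m4 r0 s = t by rewrite -[RHS](Cm4.1.1 r0) m4t tpermL gt.
have keep r : (m4 r b = m2 r b) * (m4 r c = m2 r c).
  by split; rewrite keep4 ?keep3 // !inE eqxx ?orbT.
have m4miss r : r != r0 -> m3 r t = t -> m4 r t = t.
  by move=> rr rt; rewrite m4t tpermD // eq_sym ?notg.
apply: (tail_contra Esym Eirr nocol Eac Eab cb Ea' degc excol_c Cm4 sp4 _ _ Ews r0s
  (m4miss _ alr' alt') (m4miss _ alr alt) st wa sacb tacb wt ds).
  by rewrite keep alc.
by rewrite keep.
Qed.

(** Each vertex is adjacent to at most two of b, c, s. The 5 is the slack: b, c and t are adjacent
    to at most one of them, and s to none. *)
Lemma count3 (V : {set T}) s t : (forall u v, E u v -> v \in V) ->
  (forall w, E w b -> E w c -> E w s -> False) ->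
  uniq [:: b; c; s; t] -> t \in V -> s \in V ->
  ~~ E s b -> ~~ E s c -> ~~ E t b -> ~~ E t c ->
  deg E b + deg E c + deg E s + 5 <= 2 * #|V|.
Proof.
move=> EV no_w uq tV sV sb sc tb tc.
have degE v : deg E v = \sum_(u in V) E v u.
  rewrite /deg -sum1_card big_mkcond [RHS]big_mkcond; apply: eq_bigr => u _.
  by rewrite inE; have := EV v u; case: (E v u) => // [->//|_]; rewrite if_same.
have one v : v \in V -> \sum_(u in V) (u == v) = 1.
  by move=> vV; rewrite (bigD1 v) //= eqxx big1 // => u /andP[_ /negPf->].
have [bV cV] : b \in V /\ c \in V by split; [apply: EV Eab | apply: EV Eac].
have -> : deg E b + deg E c + deg E s + 5 =
    \sum_(u in V) (E b u + E c u + E s u + ((u == b) + (u == c) + (u == t) + (u == s) + (u == s))).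
  by rewrite !big_split /= !one // !degE.
rewrite mulnC -sum_nat_const; apply: leq_sum => u _.
move: uq; rewrite /= !inE !negb_or => /and4P[/and3P[nbc nbs nbt] /andP[ncs nct] nst _].
have [->|ub] := eqVneq u b.
  rewrite Eirr (negPf nbc) (negPf nbs) (negPf nbt) (negPf sb).
  by case: (E c b).
have [->|uc] := eqVneq u c.
  by rewrite Eirr (negPf ncs) (negPf nct) (negPf sc); case: (E b c).
have [->|ut] := eqVneq u t.
  by rewrite ![E _ t]Esym (negPf tb) (negPf tc) eq_sym (negPf nst); case: (E t s).
have [->|us] := eqVneq u s.
  by rewrite ![E _ s]Esym (negPf sb) (negPf sc) Eirr.
have := no_w u; rewrite ![E u _]Esym.
by case: (E b u); case: (E c u); case: (E s u) => //= H; case: H.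
Qed.

Lemma not_adj t : t != a -> deg E t < #|C| -> ~~ E t b /\ ~~ E t c.
Proof.
move=> ta dt; split; apply/negP; rewrite Esym => et; move: dt.
  by rewrite deg_adj_b // ltnn.
by rewrite deg_adj_c // ltnn.
Qed.

Lemma two_low_count (V : {set T}) s t : (forall u v, E u v -> v \in V) -> s \in V -> t \in V ->
  s != t -> s != a -> t != a -> deg E s < #|C| -> deg E t < #|C| ->
  2 * #|C| + deg E s + 5 <= 2 * #|V|.
Proof.
move=> EV sV tV st sa ta ds dt.
have [sb sc] := not_adj sa ds; have [tb tc] := not_adj ta dt.
have out v : v != a -> deg E v < #|C| -> v \notin [:: a; b; c].
  move=> va dv; rewrite !inE !negb_or va /=; apply/andP; split.
    by apply: contraTneq dv => ->; rewrite degb ltnn.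
  by apply: contraTneq dv => ->; rewrite degc ltnn.
have sabc := out _ sa ds; have tabc := out _ ta dt.
have -> : 2 * #|C| + deg E s = deg E b + deg E c + deg E s by rewrite degb degc mul2n addnn.
apply: (@count3 V s t) => //.
  move=> w Ewb Ewc Ews; have [wa|wa] := eqVneq w a.
    by move: Ews sabc; rewrite wa => /Ea [] ->; rewrite !inE eqxx ?orbT.
  exact: (no_low_common_nbr Esym Eirr nocol Eab Eac bc Ea degb excol Ewb Ewc Ews wa sabc ds).
move: sabc tabc; rewrite /= !inE !negb_or => /and3P[_ nsb nsc] /and3P[_ ntb ntc].
by rewrite bc st ![b == _]eq_sym ![c == _]eq_sym nsb nsc ntb ntc.
Qed.

Lemma low_next_full_count (V : {set T}) s t : (forall u v, E u v -> v \in V) -> E s t ->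
  t != a -> deg E s = #|C| -> deg E t + 3 <= #|C| -> 3 * #|C| + 5 <= 2 * #|V|.
Proof.
move=> EV Est ta ds dt.
have dt' : deg E t < #|C| by apply: leq_trans dt; rewrite addn3 ltnS -addn2 leq_addr.
have [tb tc] := not_adj ta dt'.
have tabc : t \notin [:: a; b; c].
  rewrite !inE !negb_or ta /=; apply/andP; split.
    by apply: contraTneq dt' => ->; rewrite degb ltnn.
  by apply: contraTneq dt' => ->; rewrite degc ltnn.
have sa : s != a by apply: contraNneq tb => e; move: Est tabc; rewrite e => /Ea [] ->; rewrite !inE eqxx ?orbT.
have sabc : s \notin [:: a; b; c].
  rewrite !inE !negb_or sa /=; apply/andP; split.
    by apply: contraNneq tb => <-; rewrite Esym.
  by apply: contraNneq tc => <-; rewrite Esym.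
have sb : ~~ E s b by apply/negP; rewrite Esym => Ebs; apply: no_low_path_b Ebs sa Est tabc dt.
have sc : ~~ E s c by apply/negP; rewrite Esym => Ecs; apply: no_low_path_c Ecs sa Est tabc dt.
have -> : 3 * #|C| = deg E b + deg E c + deg E s by rewrite degb degc ds !mulSn mul0n addn0 addnA.
apply: (@count3 V s t) => //; last 2 first.
- exact: EV Est.
- by apply: (EV t); rewrite Esym.
- move=> w Ewb Ewc Ews; have [wa|wa] := eqVneq w a.
    by move: Ews sabc; rewrite wa => /Ea [] ->; rewrite !inE eqxx ?orbT.
  exact: no_common_nbr_next_low Ewb Ewc Ews Est wa sabc tabc ds dt.
move: sabc tabc; rewrite /= !inE !negb_or => /and3P[_ nsb nsc] /and3P[_ ntb ntc].
rewrite bc ![b == _]eq_sym ![c == _]eq_sym nsb nsc ntb ntc.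
by rewrite (adj_neq Eirr Est).
Qed.

End BothNeighbours.

(** * Fans and Vizing's adjacency lemma *)

Section Fans.

Variables (T C : finType) (E : rel T).
Hypothesis Esym : symmetric E.
Hypothesis Eirr : irreflexive E.
Hypothesis nocol : forall m : C -> T -> T, ~ coloring E m.

Implicit Types (m : C -> T -> T) (x y z : T) (r : C) (rs : seq C).

(** A Vizing fan at [x], recorded by its colours: each is missing at the current vertex and leads
    from [x] to the next one. A colour missing at [x] is not excluded; [fan_free] then fills the
    hole at once. *)
Fixpoint fan m x y rs : Prop :=
  if rs is r :: rs' then m r y = y /\ fan m x (m r x) rs' else True.

Definition fan_end m x y rs := last y [seq m r x | r <- rs].

Lemma fan_agree m m' x y rs : (forall r, r \in rs -> m' r =1 m r) ->
  fan m x y rs -> fan m' x y rs /\ fan_end m' x y rs = fan_end m x y rs.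
Proof.
rewrite /fan_end; elim: rs y => //= r rs IHrs y eqm [ry fr].
rewrite !(eqm r) ?mem_head //; have [|f e] := IHrs (m r x) _ fr; last by rewrite e.
by move=> r' rr; apply: eqm; rewrite inE rr orbT.
Qed.

(** The hole is shifted along the fan until its end, where [r] fills it. As the colours are
    distinct, a shift leaves the rest of the fan intact. *)
Lemma fan_free rs m x y r : coloring (minus E x y) m -> E x y -> fan m x y rs -> uniq rs ->
  m r x = x -> m r (fan_end m x y rs) = fan_end m x y rs -> False.
Proof.
elim: rs m y => [|r1 rs IHrs] m y Cm Exy /= fr urs rx re.
  by apply: nocol; apply: fill_coloring Esym Cm (adj_neq Eirr Exy) Exy rx re.
have [r1y {}fr] := fr; have /andP[r1rs {}urs] := urs.
have xy := adj_neq Eirr Exy.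
have [r1x|r1x] := eqVneq (m r1 x) x.
  by apply: nocol; apply: fill_coloring Esym Cm xy Exy r1x r1y.
have yx : y != x by rewrite eq_sym.
have Eyx : E y x by rewrite Esym.
have Cm' := shift_coloring Esym (hole_sym Cm) yx Eyx r1y r1x.
have E1 : E x (m r1 x) by have /andP[] := colored_adj Cm r1x.
have [|fr' ee] := @fan_agree m (shift m r1 y x) x (m r1 x) rs _ fr.
  by move=> r' rr v; apply: shiftN; apply: contraNneq r1rs => <-.
have rr1 : r != r1 by apply: contraNneq r1x => <-; rewrite rx.
by apply: IHrs Cm' E1 fr' urs _ _; rewrite ?ee shiftN.
Qed.

Definition fan_step m x : rel T :=
  fun z z' => [exists r, [&& m r z == z, m r x == z' & m r x != x]].

Lemma fan_path m x y s : path (fan_step m x) y s ->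
  exists2 rs, fan m x y rs & [seq m r x | r <- rs] = s.
Proof.
elim: s y => [|z s IHs] y /=; first by exists [::].
case/andP=> /existsP[r /and3P[/eqP ry /eqP rx _]] /IHs[rs fr es].
by exists (r :: rs); rewrite /= rx ?es.
Qed.

Lemma connect_fan_free m x y z r : coloring (minus E x y) m -> E x y ->
  connect (fan_step m x) y z -> m r x = x -> m r z = z -> False.
Proof.
(* A shortened path has distinct vertices, hence the distinct colours that [fan_free] requires. *)
move=> Cm Exy /connectP[s0 ps0 ->] rx; case/shortenP: ps0 => s ps us _ rz.
have [rs fr es] := fan_path ps.
have urs : uniq rs by apply: (@map_uniq _ _ (fun r => m r x)); rewrite es; case/andP: us.
by apply: (fan_free Cm Exy fr urs rx); rewrite /fan_end es.
Qed.

Lemma connect_fan_adj m x y z : coloring (minus E x y) m -> E x y ->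
  connect (fan_step m x) y z -> E x z.
Proof.
move=> Cm Exy /connectP[s]; elim/last_ind: s z => [|s z' _] z /=; first by move=> _ ->.
rewrite rcons_path last_rcons => /andP[_ /existsP[r /and3P[_ /eqP <- rx]]] ->.
by have /andP[] := colored_adj Cm rx.
Qed.

(** For a colour [d] missing at [x], the (d, r)-chain of a fan vertex missing [r] must contain [x],
    since otherwise its swap would make [d] missing at a fan vertex. Then [x], [z] and [z'] would be
    three ends of one chain. *)
Lemma fan_disjoint m x y z z' r : coloring (minus E x y) m -> E x y -> deg E x <= #|C| ->
  connect (fan_step m x) y z -> connect (fan_step m x) y z' -> m r z = z -> m r z' = z' -> z = z'.
Proof.
move=> Cm Exy dx; have [d dxx] : exists d, m d x = x.
  have /set0Pn[d] : miss m x != set0.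
    rewrite -card_gt0 -(ltn_add2r (deg E x)) (card_miss_end Eirr Cm Exy) add0n ltnS.
    exact: dx.
  by rewrite inE => /eqP; exists d.
have apart u : connect (fan_step m x) y u -> m r u = u -> ~~ kcomp m d r u x -> False.
  move=> yu ru nux; set D := kcomp m d r u; set m1 := swap m d r D.
  have Cm1 : coloring (minus E x y) m1 by apply: kcomp_swap.
  have m1x q : m1 q x = m q x by apply: swap_out.
  (* Take the first vertex of the fan path that is in [D] and misses [r]: before it, no colour used
     by the path is altered by the swap. *)
  suff [w yw /andP[Dw rw]] : exists2 w, connect (fan_step m1 x) y w & D w && (m r w == w).
    by apply: (connect_fan_free Cm1 Exy yw (r := d)); rewrite ?m1x // /m1 swapL // (eqP rw).
  have Qu : D u && (m r u == u) by rewrite ru eqxx /D kcomp_refl.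
  have /connectP[s ps eu] := yu; rewrite {}eu in Qu.
  elim: s (y) ps Qu => [|w s IHs] y0 /=; first by exists y0; rewrite ?connect0.
  case/andP=> st ps Qu; have [Q0|Q0] := boolP (D y0 && (m r y0 == y0)).
    by exists y0; rewrite ?connect0.
  have [w' ww' Qw'] := IHs _ ps Qu; exists w' => //; apply: connect_trans ww'; apply: connect1.
  have /existsP[q /and3P[/eqP qy qx nqx]] := st; apply/existsP; exists q; rewrite !m1x qx nqx !andbT.
  have qd : q != d by apply: contraNneq nqx => ->; rewrite dxx.
  have [eq|qr] := eqVneq q r; last by rewrite /m1 swap_id // qy.
  by rewrite /m1 swap_out ?qy // -/D; apply: contra Q0 => ->; rewrite -eq qy eqxx.
move=> yz yz' rz rz'; have [//|zz'] := eqVneq z z'.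
have sees u : connect (fan_step m x) y u -> m r u = u -> is_end m d r u.
  move=> yu ru; rewrite /is_end ru eqxx; apply/negP => /eqP/eqP du.
  by case: (connect_fan_free Cm Exy yu dxx du).
have ex : is_end m d r x.
  rewrite /is_end dxx eqxx eq_sym; apply/negP => /eqP/eqP rx.
  by case: (connect_fan_free Cm Exy yz rx rz).
have nx u : connect (fan_step m x) y u -> x != u.
  by move=> yu; apply: (adj_neq Eirr); apply: connect_fan_adj yu.
have [xz|xz] := boolP (kcomp m d r z x); last by case: (apart z).
have [xz'|xz'] := boolP (kcomp m d r z' x); last by case: (apart z').
rewrite !(kcomp_sym _ _ _ x Cm.1) in xz xz'.
by case: (ends3 Cm.1 ex (sees _ yz rz) (sees _ yz' rz') (nx _ yz) (nx _ yz') zz' xz xz').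
Qed.

(** The pairs of a fan vertex [z] and a colour [r] missing there are mapped injectively to the fan
    vertices other than [y] by [m r x]. Since [y] has [#|C|.+1 - deg E y] such colours and each
    other vertex of degree below [#|C|] has at least one, that many fan vertices must have full
    degree. *)
Lemma adjacency_lemma m x y : coloring (minus E x y) m -> E x y -> deg E x <= #|C| ->
  #|C|.+1 <= deg E y + #|[set z | [&& E x z, z != y & deg E z == #|C|]]|.
Proof.
move=> Cm Exy dx; pose F := [set z | connect (fan_step m x) y z].
have yF : y \in F by rewrite inE connect0.
pose P := [set p : T * C | (p.1 \in F) && (p.2 \in miss m p.1)].
have cardP : #|P| = \sum_(z in F) #|miss m z|.
  rewrite -sum1_card (eq_bigl (fun p : T * C => (p.1 \in F) && (p.2 \in miss m p.1))).
    by rewrite -(pair_big_dep (mem F) (fun z r => r \in miss m z) (fun _ _ => 1)) /=;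
       apply: eq_bigr => z _; rewrite sum1_card.
  by move=> p; rewrite inE.
have stepF z r : z \in F -> r \in miss m z -> m r x \in F :\ y.
  rewrite !inE => yz /eqP rz; have nrx : m r x != x.
    by apply/eqP => rx; apply: connect_fan_free Cm Exy yz rx rz.
  rewrite (hole_uncolored r Cm (adj_neq Eirr Exy)).1 /=.
  by apply: connect_trans yz (connect1 _); apply/existsP; exists r; rewrite rz nrx !eqxx.
have leP : #|P| <= #|F :\ y|.
  rewrite -(card_in_imset (f := fun p : T * C => m p.2 x) (D := mem P)).
    by apply/subset_leq_card/subsetP => _ /imsetP[[z r] /[!inE] /andP[/= zF rz] ->]; have := stepF z r; rewrite !inE; apply.
  move=> [z r] [z' r'] /[!inE] /andP[/= zF /eqP rz] /andP[/= zF' /eqP rz'] e.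
  have nrx : m r x != x.
    by apply/eqP => rx; apply: connect_fan_free Cm Exy zF rx rz.
  have er : r = r' := Cm.1.2 _ _ _ e nrx.
  by rewrite -er in rz' *; rewrite (fan_disjoint Cm Exy dx zF zF' rz rz').
have cy : #|miss m y| + deg E y = #|C|.+1.
  by apply: card_miss_end Eirr _ _ _ (hole_sym Cm) _; rewrite Esym.
rewrite -cy addnC leq_add2l -(leq_add2r #|[set z in F :\ y | deg E z != #|C|]|).
apply: leq_trans (_ : #|F :\ y| <= _); last first.
  rewrite -cardsUI; apply: leq_trans (leq_addr _ _); apply/subset_leq_card/subsetP => z zF.
  have := zF; rewrite !inE => /andP[zy yz]; rewrite zy yz /= (connect_fan_adj Cm Exy yz) /=.
  by case: eqP.
apply: leq_trans leP; rewrite cardP (big_setD1 y) //= leq_add2l.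
rewrite -sum1_card big_mkcond [leqRHS]big_mkcond; apply: leq_sum => z _.
rewrite !inE; case: ifP => // /andP[/andP[zy yz] dz]; rewrite zy yz /=.
rewrite card_gt0; apply: contraNneq dz => e.
have zx : z != x by rewrite eq_sym; apply: (adj_neq Eirr); apply: connect_fan_adj yz.
by rewrite -(card_miss_out Eirr Cm zx zy) e cards0.
Qed.

End Fans.

Lemma odd_fixpoints (T : finType) (f : T -> T) (V : {set T}) :
  involutive f -> (forall v, v \in V -> f v \in V) ->
  odd #|[set v in V | f v == v]| = odd #|V|.
Proof.
move=> fK fV; rewrite -(cardsID [set v | f v == v] V) oddD.
have -> : [set v in V | f v == v] = V :&: [set v | f v == v] by apply/setP => v; rewrite !inE.
suff -> : odd #|V :\: [set v | f v == v]| = false by rewrite addbF.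
set A := V :\: _; have : forall v, v \in A -> (f v \in A) && (f v != v).
  by move=> v; rewrite !inE fK => /andP[nv vV]; rewrite eq_sym nv fV.
move: {2}#|A| (leqnn #|A|) => n; move: (A) => {fV V}A.
elim: n A => [|n IHn] A; first by rewrite leqn0 => /eqP->.
move=> An fA; have [->|/set0Pn[v vA]] := eqVneq A set0; first by rewrite cards0.
have /andP[fvA nfv] := fA v vA.
have e : #|A| = #|A :\ v :\ f v|.+2.
  by rewrite (cardsD1 v A) vA (cardsD1 (f v) (A :\ v)) !inE nfv fvA.
rewrite e /= negbK; apply: IHn => [|u]; first by move: An; rewrite e => /ltnW.
rewrite !inE => /and3P[uf uv uA]; have /andP[-> ->] := fA u uA; rewrite !andbT.
by rewrite (inj_eq (inv_inj fK)) uv /=; apply: contra uf => /eqP<-; rewrite fK.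
Qed.

(** * The subgraph of the free colours and the hole *)

Section HoleSubgraph.

Variables (T C : finType) (E : rel T).
Hypothesis Esym : symmetric E.
Hypothesis Eirr : irreflexive E.
Hypothesis nocol : forall m : C -> T -> T, ~ coloring E m.

Variables (a b : T) (m : C -> T -> T).
Hypotheses (Eab : E a b) (Cm : coloring (minus E a b) m).

Definition free_colors : {set C} := miss m a :|: miss m b.

Definition free_type := {r : C | r \in free_colors}.

Definition free_adj : rel T :=
  fun u v => (u != v) && ([exists r in free_colors, m r u == v] || same_edge a b u v).

Definition free_map (r : free_type) := m (val r).

Let ab : a != b := adj_neq Eirr Eab.

Lemma free_sym : symmetric free_adj.
Proof.
move=> u v; rewrite /free_adj eq_sym [same_edge a b v u]orbC [_ && (u == a)]andbC [_ && (u == b)]andbC.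
congr (_ && (_ || _)); apply/eq_existsb => r; congr (_ && _).
by rewrite eq_sym -(can2_eq (Cm.1.1 r) (Cm.1.1 r)) eq_sym.
Qed.

Lemma free_irr : irreflexive free_adj.
Proof. by move=> u; rewrite /free_adj eqxx. Qed.

Lemma hole_missing r u : same_edge a b u (m r u) = false.
Proof.
have nc := hole_uncolored r Cm ab.
by apply/negP => /orP[] /andP[/eqP->]; rewrite ?(negPf nc.1) ?(negPf nc.2).
Qed.

Lemma free_coloring : coloring (minus free_adj a b) free_map.
Proof.
split; first split.
- by move=> r; apply: Cm.1.1.
- by move=> p q u e n; apply: val_inj; apply: Cm.1.2 e n.
move=> u v uv; rewrite /minus /free_adj uv /=.
apply/existsP/andP => [[r /eqP <-]|[/orP[/existsP[r /andP[rF /eqP rv]]|->]//]].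
  rewrite /free_map hole_missing; split=> //; apply/orP; left.
  by apply/existsP; exists (val r); rewrite (valP r) /=.
by move=> _; exists (exist _ r rF); rewrite /free_map /= rv.
Qed.

(** The classes of [m'], together with those of [m] for the other colours, would colour [E]; by
    [cross] they never use the same edge twice. *)
Lemma free_nocol (m' : free_type -> T -> T) : ~ coloring free_adj m'.
Proof.
move=> [[m'K m'inj] m'R].
pose mm (r : C) v := if insub r is Some r' then m' r' v else m r v.
have mmF r (rF : r \in free_colors) v : mm r v = m' (exist _ r rF) v.
  by rewrite /mm insubT.
have mmN r v : r \notin free_colors -> mm r v = m r v by move=> rF; rewrite /mm insubN.
have cross p q u : p \in free_colors -> q \notin free_colors -> mm p u = mm q u -> mm p u = u.
  move=> pF qF; rewrite (mmN q u qF) (mmF _ pF) => e; apply/eqP/negPn/negP => nu.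
  have : free_adj u (m' (exist _ p pF) u).
    by rewrite -m'R 1?eq_sym //; apply/existsP; exists (exist _ p pF).
  rewrite /free_adj e hole_missing orbF => /andP[_ /existsP[r /andP[rF /eqP er]]].
  have rq : r = q by apply: (Cm.1.2 _ _ u er); rewrite er -e.
  by rewrite -rq rF in qF.
apply: (nocol (m := mm)); split; first split.
- move=> r v; have [rF|rF] := boolP (r \in free_colors); first by rewrite !(mmF _ rF) m'K.
  by rewrite !mmN // Cm.1.1.
- move=> p q u e n; have [pF|pF] := boolP (p \in free_colors); have [qF|qF] := boolP (q \in free_colors).
  + by move: e n; rewrite (mmF _ pF) (mmF _ qF) => e n; have [] := m'inj _ _ _ e n.
  + by rewrite (cross _ _ _ pF qF e) eqxx in n.
  + by rewrite e (cross _ _ _ qF pF (esym e)) eqxx in n.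
  + by move: e n; rewrite !mmN //; apply: Cm.1.2.
have free_mm u v : free_adj u v -> exists r, mm r u == v.
  move=> Fuv; have : u != v by case/andP: Fuv.
  by move/m'R; rewrite Fuv => /existsP[[r rF] rv]; exists r; rewrite (mmF _ rF).
move=> u v uv; apply/existsP/idP => [[r /eqP]|Euv].
  have [rF|rF] := boolP (r \in free_colors).
    rewrite (mmF _ rF) => ev; have : free_adj u v.
      by rewrite -m'R //; apply/existsP; exists (exist _ r rF); rewrite ev.
    rewrite /free_adj uv /= => /orP[/existsP[q /andP[_ /eqP eq]]|].
      by have := colored_adj Cm (r := q) (v := u); rewrite eq eq_sym uv => /(_ isT) /andP[].
    by move=> /orP[] /andP[/eqP-> /eqP->]; rewrite // Esym.
  rewrite mmN // => eq.
  by have := colored_adj Cm (r := r) (v := u); rewrite eq eq_sym uv => /(_ isT) /andP[].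
have [se|se] := boolP (same_edge a b u v).
  by apply: free_mm; rewrite /free_adj uv se orbT.
have [r rv] := adj_colored Eirr Cm Euv se.
have [rF|rF] := boolP (r \in free_colors); last by exists r; rewrite mmN // rv.
by apply: free_mm; rewrite /free_adj uv; apply/orP; left; apply/existsP; exists r; rewrite rF rv /=.
Qed.

Lemma free_adj_sub u v : free_adj u v -> E u v.
Proof.
case/andP=> uv /orP[/existsP[r /andP[_ /eqP rv]]|/orP[] /andP[/eqP-> /eqP->]] //.
  by have := colored_adj Cm (r := r) (v := u); rewrite rv eq_sym uv => /(_ isT) /andP[].
by rewrite Esym.
Qed.

Lemma card_free_type : #|{: free_type}| = #|free_colors|.
Proof. by rewrite card_sig. Qed.

Lemma miss_free v : #|miss free_map v| = #|miss m v :&: free_colors|.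
Proof.
rewrite -(card_imset _ val_inj); apply: eq_card => r; rewrite inE; apply/imsetP/andP.
  by case=> r'; rewrite inE => rv ->; rewrite inE (valP r').
by case=> rv rF; exists (exist _ r rF); rewrite // inE; move: rv; rewrite inE.
Qed.

Lemma deg_free v : v != a -> v != b ->
  #|miss m v :&: free_colors| + deg free_adj v = #|free_colors|.
Proof.
by move=> va vb; rewrite -miss_free (card_miss_out free_irr free_coloring va vb) card_free_type.
Qed.

(** A colour missing at both a and b would fill the hole, so the two sets of missing colours are
    disjoint. *)
Lemma card_free_colors : #|free_colors| + deg E a + deg E b = 2 * #|C|.+1.
Proof.
have dis : miss m a :&: miss m b = set0.
  apply/setP => r; rewrite !inE; apply/negP => /andP[/eqP ra /eqP rb].
  by apply: nocol; apply: fill_coloring Esym Cm ab Eab ra rb.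
have := cardsUI (miss m a) (miss m b); rewrite dis cards0 addn0 -/free_colors.
have := card_miss_end Eirr Cm Eab.
have := card_miss_end Eirr (hole_sym Cm) (etrans (Esym b a) Eab).
lia.
Qed.

End HoleSubgraph.

(** * No further low vertex, and the resulting count of missed colours *)

Section Critical.

Variables (T C : finType) (E : rel T) (V : {set T}).
Hypothesis Esym : symmetric E.
Hypothesis Eirr : irreflexive E.
Hypothesis EV : forall u v, E u v -> v \in V.
Hypothesis nocol : forall m : C -> T -> T, ~ coloring E m.
Hypothesis crit : forall x y, E x y -> exists m : C -> T -> T, coloring (minus E x y) m.

Variable k : nat.
Hypothesis degV : forall v, v \in V -> k <= deg E v <= #|C|.

Lemma ex_full_nbr x y : E x y -> exists2 z, E x z & (z != y) && (deg E z == #|C|).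
Proof.
move=> Exy; have [m Cm] := crit Exy.
have dV v u : E u v -> deg E v <= #|C| by move=> /EV /degV /andP[].
have := adjacency_lemma Esym Eirr nocol Cm Exy (dV x y (etrans (Esym y x) Exy)).
have := dV _ _ Exy; set W := [set z | _] => h1 h2.
have /set0Pn[z] : W != set0 by rewrite -card_gt0; lia.
by rewrite inE => /and3P[]; exists z => //; apply/andP.
Qed.

Variables a b : T.
Hypotheses (Eab : E a b) (dega : deg E a = k) (degb : deg E b = #|C|).

Let ab : a != b := adj_neq Eirr Eab.

Lemma two_le_k : 2 <= k.
Proof.
have [z Eaz /andP[zb _]] := ex_full_nbr Eab; rewrite -dega /deg.
have <- : #|[set b; z]| = 2 by rewrite cards2 eq_sym zb.
by apply/subset_leq_card/subsetP => u; rewrite !inE => /orP[] /eqP->.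
Qed.

Hypothesis large : 2 * #|V| + 5 * k <= 3 * #|C| + 12.

(* [a] has exactly two neighbours along free colours: [b] and the neighbour
   along the colour missing at [b]. *)
Lemma no_free_miss (m : C -> T -> T) v : coloring (minus E a b) m -> v \in V -> v != a -> v != b ->
  miss m v :&: free_colors a b m = set0.
Proof.
move=> Cm vV va vb; set F := free_colors a b m; set E' := free_adj a b m.
have addE0 (x d f : nat) : x + d = f -> ~~ (d < f) -> x = 0 by clear; lia.
have addEf (x d f : nat) : x + d = f -> ~~ (d < f) -> d = f by clear; lia.
have add_gt0 (x d f : nat) : x + d = f -> d < f -> 0 < x by clear; lia.
(* From here on [f] and [q] count the free and all colours, [y] and [x] the colours and the free
   colours missed at a vertex, [d] and [d'] its degrees in [E] and [E'], and [n] the vertices. *)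
have miss_few (x y d d' f q : nat) :
  x <= y -> y + d = q -> x + d' = f -> k <= d -> f + k = q + 2 -> 0 < d' by clear; lia.
have miss_all (f y d q : nat) : f <= y -> y + d = q -> k <= d -> f + k = q + 2 -> False by clear; lia.
have too_large (f q n : nat) :
  f + k = q + 2 -> 2 <= k -> 2 * n + 5 * k <= 3 * q + 12 -> 3 * f + 5 <= 2 * n -> False by clear; lia.
have many_full (f fc x y d d' q n w : nat) : f + fc = q -> x <= y -> y + d = q -> x + d' = f ->
    2 * f + d' + 5 <= 2 * n -> q < d + w -> f + k = q + 2 -> 2 <= k ->
    2 * n + 5 * k <= 3 * q + 12 -> fc < w.
  by clear; lia.
have full_free (x y d d' f q : nat) : x <= y -> y + d = q -> d = q -> x + d' = f -> d' = f.
  by clear; lia.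
(* Here [d' <= f + 1 - 2 * k], which is [f - 3] for [k = 2]: the constant 12 leaves no room. *)
have three_less (f q d' n : nat) : f + k = q + 2 -> 2 <= k -> 2 * n + 5 * k <= 3 * q + 12 ->
  2 * f + d' + 5 <= 2 * n -> d' + 3 <= f by clear; lia.
have k2 := two_le_k.
have cF : #|F| + k = #|C| + 2 by have := card_free_colors Esym Eirr nocol Eab Cm; rewrite dega degb -/F; lia.
have cb : #|miss m b| = 1.
  by have := card_miss_end Eirr (hole_sym Cm) (etrans (Esym b a) Eab); rewrite degb; lia.
have [be bE] : exists be, miss m b = [set be] by apply/cards1P; rewrite cb.
have beb : m be b = b by apply/eqP; have := set11 be; rewrite -bE inE.
have nofill r : m r a = a -> m r b = b -> False.
  by move=> ra rb; apply: nocol; apply: fill_coloring Esym Cm ab Eab ra rb.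
set c := m be a.
have ca : c != a by apply/eqP => /nofill; apply.
have bc : b != c by rewrite eq_sym (hole_uncolored be Cm ab).1.
have beF : be \in F by rewrite inE bE inE eqxx orbT.
have E'ab : E' a b by rewrite /E' /free_adj ab /same_edge !eqxx orbT.
have E'ac : E' a c.
  by rewrite /E' /free_adj eq_sym ca; apply/orP; left; apply/existsP; exists be; rewrite beF eqxx.
have E'a u : E' a u -> u = b \/ u = c.
  case/andP=> au /orP[/existsP[r /andP[rF /eqP ru]]|]; last first.
    by rewrite /same_edge eqxx (negPf ab) /= orbF => /eqP; left.
  right; suff e : r = be by rewrite -ru e.
  move: rF; rewrite !inE ru eq_sym (negPf au) /= => rb.
  by apply/eqP; rewrite -in_set1 -bE inE.
have CF := card_free_type a b m.
have Cm' := free_coloring Eirr Eab Cm.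
have E'irr : irreflexive E' := @free_irr _ _ a b m.
have E'sym : symmetric E' := free_sym Cm.
have no' : forall m', ~ coloring E' m' := free_nocol Esym Eirr nocol Eab Cm.
have db : deg E' b = #|{: free_type a b m}|.
  have := card_miss_end E'irr (hole_sym Cm') (etrans (E'sym b a) E'ab).
  rewrite (miss_free a b m b) bE (_ : [set be] :&: _ = [set be]) ?cards1 ?add1n; first by case.
  by apply/setIidPl; rewrite sub1set.
have ex' : exists m' : free_type a b m -> T -> T, coloring (minus E' a b) m' by exists (free_map (a := a) (b := b) (m := m)).
have E'V u w : E' u w -> w \in V by move/(free_adj_sub Esym Eab Cm)/EV.
have low u : u \in V -> u != a -> deg E' u < #|F| -> [/\ u != b, u != c & u \in V].
  move=> uV ua du; split=> //; apply: contraTneq du => ->; rewrite -CF.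
    by rewrite db ltnn.
  by rewrite (deg_c E'sym E'irr no' E'ab E'ac bc E'a db ex') ltnn.
have degM u : u \in V -> u != a -> u != b -> #|miss m u| + deg E u = #|C|.
  by move=> _ ua ub; apply: (card_miss_out Eirr Cm).
have degF u : u != a -> u != b -> #|miss m u :&: F| + deg E' u = #|F|.
  exact: (deg_free Eirr Eab Cm).
have mV r u : u \in V -> m r u \in V.
  move=> uV; have [->//|nu] := eqVneq (m r u) u.
  by have /andP[/EV] := colored_adj Cm nu.
(* If only one vertex missed a free colour, it would miss all of them, by parity. *)
have other s : s \in V -> s != a -> deg E' s < #|F| -> exists t, [/\ t \in V, t != a, t != s & deg E' t < #|F|].
  move=> sV sa ds; have [sb _ _] := low _ sV sa ds.
  have [/existsP[t /and4P[tV ta ts dt]]|none] := boolP [exists t, [&& t \in V, t != a, t != s & deg E' t < #|F|]].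
    by exists t.
  have full u : u \in V -> u != a -> u != b -> u != s -> miss m u :&: F = set0.
    move=> uV ua ub us; apply/eqP; rewrite -cards_eq0; apply/eqP.
    apply: (addE0 _ _ _ (degF u ua ub)).
    by move: none; rewrite negb_exists => /forallP/(_ u); rewrite uV ua us.
  (* A free colour is missed by exactly one of a and b, by s perhaps, and by nobody else; so the
     parity of the order tells whether s misses it, with the same answer for all free colours. *)
  have par x : x \in F -> odd #|V| = ~~ (x \in miss m s).
    move=> xF; rewrite -(odd_fixpoints (Cm.1.1 x) (mV x)).
    have fixE u : (u \in [set v0 in V | m x v0 == v0]) = (u \in V) && (x \in miss m u).
      by rewrite !inE.
    have [e eE eab] : exists2 e, e \in V & (e == a) || (e == b) /\ (x \in miss m e).
      move: xF; rewrite inE => /orP[xa|xb].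
        by exists a; [apply: (EV (u := b)); rewrite Esym | rewrite eqxx].
      by exists b; [apply: EV Eab | rewrite eqxx orbT].
    have es : e != s by apply: contraTneq eab.1 => ->; rewrite negb_or sa sb.
    have uniq_e u : u \in V -> u != s -> x \in miss m u -> u = e.
      move=> uV us xu; have [ua|ua] := eqVneq u a; last first.
        have [ub|ub] := eqVneq u b; last by have /setP/(_ x) := full u uV ua ub us; rewrite in_setI in_set0 xu xF.
        case: eab => /orP[/eqP ea|/eqP eb] xe; last by rewrite ub eb.
        by case: (nofill x); apply/eqP; [move: xe; rewrite ea inE | move: xu; rewrite ub inE].
      case: eab => /orP[/eqP ea|/eqP eb] xe; first by rewrite ua ea.
      by case: (nofill x); apply/eqP; [move: xu; rewrite ua inE | move: xe; rewrite eb inE].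
    have [xs|xs] := boolP (x \in miss m s).
      have -> : [set v0 in V | m x v0 == v0] = [set e; s].
        apply/setP => u; rewrite fixE !in_set2; apply/andP/orP => [[uV xu]|[] /eqP->]; last 2 first.
        + by rewrite eE eab.2.
        + by rewrite sV xs.
        by have [us|us] := eqVneq u s; [right|left; apply/eqP; apply: uniq_e].
      by rewrite cards2 es.
    have -> : [set v0 in V | m x v0 == v0] = [set e].
      apply/setP => u; rewrite fixE in_set1; apply/andP/eqP => [[uV xu]|->]; last by rewrite eE eab.2.
      by apply: uniq_e => //; apply: contraNneq xs => <-.
    by rewrite cards1.
  have /set0Pn[x] : miss m s :&: F != set0 by rewrite -card_gt0; apply: (add_gt0 _ _ _ (degF s sa sb) ds).
  rewrite inE => /andP[xs xF].
  have sub : F \subset miss m s.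
    by apply/subsetP => y yF; have := par y yF; rewrite (par x xF) xs => /esym/negbFE.
  (* Missing all free colours would leave s a degree of at most [k - 2]. *)
  have /andP[ks _] := degV sV; by case: (miss_all _ _ _ _ (subset_leq_card sub) (degM s sV sa sb) ks cF).
have low_deg s : s \in V -> s != a -> deg E' s < #|F| -> 2 * #|F| + deg E' s + 5 <= 2 * #|V|.
  move=> sV sa ds; have [t [tV ta ts dt]] := other s sV sa ds; rewrite -CF in ds dt *.
  by apply: (two_low_count E'sym E'irr no' E'ab E'ac bc E'a db ex' E'V sV tV) => //; rewrite eq_sym.
apply/eqP; rewrite -cards_eq0; apply/eqP/(addE0 _ _ _ (degF v va vb)); apply/negP => dv.
have low_v := low_deg v vV va dv.
have next s : E' s v -> deg E' s = #|F| -> False.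
  move=> Esv ds; apply: (too_large _ _ _ cF k2 large).
  have dv3 := three_less _ _ _ _ cF k2 large low_v; rewrite -CF in ds dv3 *.
  exact: (low_next_full_count E'sym E'irr no' E'ab E'ac bc E'a db ex' E'V Esv va ds).
have [vb' vc _] := low v vV va dv.
have nbr : exists s, E' v s.
  have /set0Pn[s] : [set s | E' v s] != set0.
    have /andP[kv _] := degV vV; rewrite -card_gt0.
    exact: (miss_few _ _ _ _ _ _ (subset_leq_card (subsetIl _ _)) (degM v vV va vb) (degF v va vb) kv cF).
  by rewrite inE => vs; exists s.
have nva s : E' v s -> s != a.
  move=> Evs; apply/eqP => sa; move: Evs; rewrite sa E'sym => /E'a [] e.
    by rewrite e eqxx in vb.
  by rewrite e eqxx in vc.
have nvb s : E' v s -> s != b.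
  move=> Evs; apply/eqP => sb; move: Evs; rewrite sb E'sym => Ebv.
  by move: dv; rewrite (deg_adj_b E'sym E'irr no' E'ab E'ac bc E'a db ex' Ebv va) CF ltnn.
case: nbr => s Evs; have sa := nva s Evs; have sb := nvb s Evs.
have sV := E'V _ _ Evs.
have [ds|ds] := boolP (deg E' s < #|F|); last first.
  by apply: (next s); [rewrite E'sym | apply: (addEf _ _ _ (degF s sa sb) ds)].
have low_s := low_deg s sV sa ds.
have Evs' := free_adj_sub Esym Eab Cm Evs.
have [m2 Cm2] := crit Evs'; have /andP[_ dv2] := degV vV.
have := adjacency_lemma Esym Eirr nocol Cm2 Evs' dv2; set W := [set z | _] => cW.
(* [low_s] bounds the degree of [s] in [E'], so [s] misses many colours; the adjacency lemma turns
   these into neighbours of [v] of full degree, more than there are colours outside [F]. *)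
have Wbig : #|~: F| < #|W|.
  exact: (many_full _ _ _ _ _ _ _ _ _ (cardsC F) (subset_leq_card (subsetIl _ _))
    (degM s sV sa sb) (degF s sa sb) low_s cW cF k2 large).
have [z zW zE'] : exists2 z, z \in W & E' v z.
  apply/exists_inP; apply: contraTT Wbig => /exists_inPn noz.
  rewrite -leqNgt.
  have sub : W \subset [set m r v | r in ~: F].
    apply/subsetP => z zW; have := noz z zW; move: (zW); rewrite inE => /and3P[Evz _ _] nE.
    have [r rz] : exists r, m r v = z.
      by apply: (adj_colored Eirr Cm Evz); rewrite /same_edge (negPf va) (negPf vb).
    apply/imsetP; exists r; last by rewrite rz.
    rewrite inE; apply: contra nE => rF; rewrite /E' /free_adj (adj_neq Eirr Evz) /=.
    by apply/orP; left; apply/existsP; exists r; rewrite rF rz /=.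
  exact: leq_trans (subset_leq_card sub) (leq_imset_card _ _).
move: zW; rewrite inE => /and3P[_ _ /eqP dz].
apply: (next z); first by rewrite E'sym.
have za := nva z zE'; have zb := nvb z zE'.
exact: (full_free _ _ _ _ _ _ (subset_leq_card (subsetIl _ _)) (degM z (E'V _ _ zE') za zb) dz (degF z za zb)).
Qed.

(** In a colouring of G - ab each colour is missed by one vertex, so the missed colours add up to
    [#|C|]. The 2 is the uncoloured edge, counted at both of its ends. *)
Lemma deficiency : odd #|V| /\ #|C| + \sum_(v in V) deg E v = #|C| * #|V| + 2.
Proof.
have [m Cm] := crit Eab; have k2 := two_le_k.
have aV : a \in V by apply: (EV (u := b)); rewrite Esym.
have bV : b \in V := EV Eab.
have mV r u : u \in V -> m r u \in V.
  move=> uV; have [->//|nu] := eqVneq (m r u) u.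
  by have /andP[/EV] := colored_adj Cm nu.
pose fixed r := [set v in V | m r v == v].
have nofill r : m r a = a -> m r b = b -> False.
  by move=> ra rb; apply: nocol; apply: fill_coloring Esym Cm ab Eab ra rb.
have freeE (m' : C -> T -> T) v r : coloring (minus E a b) m' -> v \in V -> v != a -> v != b ->
    r \in free_colors a b m' -> m' r v != v.
  move=> Cm' vV va vb rF; have /setP/(_ r) := no_free_miss Cm' vV va vb.
  by rewrite in_setI rF andbT !inE => ->.
have fixa r : m r a = a -> fixed r = [set a].
  move=> ra; apply/setP => u; rewrite !inE; apply/andP/eqP => [[uV /eqP ru]|->]; last by rewrite ra.
  apply/eqP/negPn/negP => ua; have ub : u != b by apply/eqP => e; apply: (nofill r ra); rewrite -e.
  by have := freeE m u r Cm uV ua ub; rewrite !inE ra eqxx ru eqxx => /(_ isT).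
have fixb r : m r b = b -> fixed r = [set b].
  move=> rb; apply/setP => u; rewrite !inE; apply/andP/eqP => [[uV /eqP ru]|->]; last by rewrite rb.
  apply/eqP/negPn/negP => ub; have ua : u != a by apply/eqP => e; apply: (nofill r) => //; rewrite -e.
  by have := freeE m u r Cm uV ua ub; rewrite !inE rb eqxx orbT ru eqxx => /(_ isT).
have [al ala] : exists al, m al a = a.
  have /set0Pn[al] : miss m a != set0.
    have /andP[_] := degV aV; have := card_miss_end Eirr Cm Eab; rewrite -card_gt0; lia.
  by rewrite inE => /eqP; exists al.
have oddV : odd #|V| by rewrite -(odd_fixpoints (Cm.1.1 al) (mV al)) -/(fixed al) fixa ?cards1.
(* Two vertices missing [r] cannot both lie on the (r, al)-component of [a];
   swapping at the other one would make it miss the free colour [al]. *)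
have one r : #|fixed r| = 1.
  have [ra|ra] := eqVneq (m r a) a; first by rewrite fixa ?cards1.
  have [rb|rb] := eqVneq (m r b) b; first by rewrite fixb ?cards1.
  have ofix : odd #|fixed r| by rewrite odd_fixpoints //; [apply: Cm.1.1 | apply: mV].
  suff : #|fixed r| <= 1 by case: #|_| ofix => [|[]].
  rewrite leqNgt; apply/negP => /card_gt1P[u [v [uf vf uv]]].
  have info w : w \in fixed r -> [/\ w \in V, w != a, w != b & m r w = w].
    rewrite inE => /andP[wV /eqP rw]; split=> //.
      by apply: contraNneq ra => <-; rewrite rw.
    by apply: contraNneq rb => <-; rewrite rw.
  have apart w : w \in fixed r -> kcomp m r al a w.
    move=> /info[wV wa wb rw]; apply/negPn/negP => naw.
    have Cm' := kcomp_swap r al w Cm.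
    have na : ~~ kcomp m r al w a by rewrite kcomp_sym //; case: Cm.
    have := freeE _ w al Cm' wV wa wb; rewrite swapR ?kcomp_refl // rw eqxx => H.
    by suff: false by []; apply: H; rewrite !inE swap_out // ala eqxx.
  have ends w : w \in fixed r -> is_end m r al w.
    move=> /info[wV wa wb rw]; rewrite /is_end rw eqxx eq_sym; apply/negP => /eqP/eqP alw.
    by have := freeE m w al Cm wV wa wb; rewrite !inE ala alw !eqxx => /(_ isT).
  have ea : is_end m r al a by rewrite /is_end ala eqxx (negPf ra).
  have [[_ ua _ _] [_ va _ _]] := (info _ uf, info _ vf).
  by case: (ends3 Cm.1 ea (ends _ uf) (ends _ vf) _ _ uv (apart _ uf) (apart _ vf)); rewrite eq_sym.
split=> //.
have sumC : \sum_r #|fixed r| = #|C|.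
  by rewrite (eq_bigr (fun=> 1)) ?sum1_card // => r _; apply: one.
have sumV : \sum_r #|fixed r| = \sum_(v in V) #|miss m v|.
  transitivity (\sum_r \sum_(v in V) (m r v == v : nat)).
    apply: eq_bigr => r _; rewrite -sum1_card big_mkcond [RHS]big_mkcond; apply: eq_bigr => v _.
    by rewrite inE; case: (v \in V); case: eqP.
  rewrite exchange_big; apply: eq_bigr => v _; rewrite -sum1_card [RHS]big_mkcond.
  by apply: eq_bigr => r _; rewrite inE; case: eqP.
rewrite -{1}sumC sumV -big_split /= (bigD1 a) //= (bigD1 b) ?bV 1?eq_sym //=.
rewrite (card_miss_end Eirr Cm Eab) (card_miss_end Eirr (hole_sym Cm)) 1?Esym //.
rewrite (eq_bigr (fun=> #|C|)); last first.
  by move=> v /andP[/andP[vV va] vb]; apply: (card_miss_out Eirr Cm).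
have := cardsD1 a V; have := cardsD1 b (V :\ a); rewrite !inE aV bV [b == a]eq_sym ab /=.
rewrite (eq_bigl (mem (V :\ a :\ b))); last first.
  by move=> v; rewrite !inE; case: (v \in V); case: (v == a); case: (v == b).
by rewrite sum_nat_const => -> ->; lia.
Qed.

End Critical.

(** * From graphs to adjacency relations and back *)

Section GraphColorings.

Variable T : finType.
Implicit Types (G H : graph T) (u v x y : T) (k : nat).

Definition adj G : rel T := fun u v => (u != v) && ([set u; v] \in edges G).

Lemma adj_sym G : symmetric (adj G).
Proof. by move=> u v; rewrite /adj eq_sym setUC. Qed.

Lemma adj_irr G : irreflexive (adj G).
Proof. by move=> u; rewrite /adj eqxx. Qed.

Lemma edge_sub G e : e \in edges G -> e \subset vertices G /\ #|e| = 2.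
Proof. by move=> eG; have /forallP/(_ e) := edges_valid G; rewrite eG => /andP[-> /eqP]. Qed.

Lemma adj_vertex G u v : adj G u v -> v \in vertices G.
Proof. by case/andP=> _ /edge_sub[/subsetP s _]; apply: s; rewrite !inE eqxx orbT. Qed.

Lemma edge_pair G e v : e \in edges G -> v \in e -> exists2 u, u != v & e = [set v; u].
Proof.
move=> eG ve; have [_ ce] := edge_sub eG.
have /cards1P[u eu] : #|e :\ v| == 1 by have := cardsD1 v e; rewrite ve ce add1n => -[<-].
exists u; first by have := set11 u; rewrite -eu !inE => /andP[].
by rewrite -(setD1K ve) eu.
Qed.

Lemma deg_degree G v : deg (adj G) v = degree G v.
Proof.
rewrite /degree /deg -(card_in_imset (f := fun u => [set v; u])); last first.
  move=> u u' /[!inE] /andP[vu _] /andP[vu' _] e.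
  have : u \in [set v; u'] by rewrite -e !inE eqxx orbT.
  by rewrite !inE eq_sym (negPf vu) /= => /eqP.
apply: eq_card => e; rewrite inE; apply/imsetP/andP.
  by case=> u; rewrite inE => /andP[_ uG] ->; rewrite uG !inE eqxx.
by case=> eG ve; have [u uv eu] := edge_pair eG ve; exists u; rewrite // inE /adj eq_sym uv -eu.
Qed.

Lemma coloring_of G k : edge_colorable G k -> exists m : 'I_k -> T -> T, coloring (adj G) m.
Proof.
case/existsP=> c /forallP cP.
have proper e f w : c e = c f -> w \in val e -> w \in val f -> e = f.
  move=> ecf we wf; apply/eqP/negPn/negP => nef.
  have /forallP/(_ f) := cP e; rewrite nef ecf eqxx /= implybF => /negP; apply.
  by apply/negP => /pred0P/(_ w); rewrite /= we wf.
pose P r v u := (u != v) && [exists e : edge_of G, (val e == [set v; u]) && (c e == r)].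
pose m r v := if [pick u | P r v u] is Some u then u else v.
have mE r v u : P r v u -> m r v = u.
  move=> Pu; have /andP[uv /existsP[e /andP[/eqP ee /eqP er]]] := Pu.
  rewrite /m; case: pickP => [w|none]; last by rewrite none in Pu.
  move=> /andP[wv /existsP[f /andP[/eqP ef /eqP fr]]].
  have eef : e = f by apply: (proper e f v); rewrite ?er ?fr ?ee ?ef // !inE eqxx.
  have : w \in [set v; u] by rewrite -ee eef ef !inE eqxx orbT.
  by rewrite !inE (negPf wv) => /eqP.
have mP r v : m r v != v -> P r v (m r v).
  by rewrite /m; case: pickP => [u //|_]; rewrite eqxx.
have Psym r v u : P r v u -> P r u v.
  case/andP=> uv /existsP[e eP]; rewrite /P eq_sym uv; apply/existsP; exists e.
  by rewrite setUC.
exists m; split; first split.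
- move=> r v; have [e|nv] := eqVneq (m r v) v; first by rewrite e.
  by apply: mE; apply: Psym; apply: mP.
- move=> p q u e nu; have := mP _ _ nu; rewrite e in nu; have := mP _ _ nu; rewrite -e.
  case/andP=> _ /existsP[f /andP[/eqP ef /eqP <-]] /andP[_ /existsP[f' /andP[/eqP ef' /eqP <-]]].
  by congr (c _); apply: val_inj; rewrite ef ef'.
move=> u v uv; apply/existsP/idP => [[r /eqP e]|].
  have : P r u v by rewrite -e; apply: mP; rewrite e eq_sym.
  case/andP=> _ /existsP[f /andP[/eqP ef _]]; rewrite /adj uv -ef; exact: valP f.
rewrite /adj uv /= => uvG; exists (c (exist _ [set u; v] uvG)).
by apply/eqP/mE; rewrite /P eq_sym uv; apply/existsP; exists (exist _ [set u; v] uvG); rewrite !eqxx.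
Qed.

Lemma colorable_of G k (m : 'I_k -> T -> T) : coloring (adj G) m -> edge_colorable G k.
Proof.
move=> [[mK m_inj] mG].
have ex (e : edge_of G) : exists r, [exists v in val e, (m r v != v) && (m r v \in val e)].
  have [_ ce] := edge_sub (valP e).
  have /set0Pn[u ue] : val e != set0 by rewrite -card_gt0 ce.
  have [v vu ee] := edge_pair (valP e) ue.
  have uv : u != v by rewrite eq_sym.
  have : adj G u v by rewrite /adj uv -ee (valP e).
  rewrite -mG // => /existsP[r /eqP er]; exists r; apply/existsP; exists u.
  by rewrite ue er vu ee !inE eqxx orbT.
pose c := [ffun e : edge_of G => xchoose (ex e)].
have cE (e : edge_of G) w : w \in val e -> val e = [set w; m (c e) w].
  move=> we; have := xchooseP (ex e); rewrite /c ffunE; set r := xchoose _.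
  case/existsP=> v /and3P[ve nv mve].
  have [u uv eu] := edge_pair (valP e) ve.
  have mu : m r v = u by move: mve; rewrite eu !inE (negPf nv) => /eqP.
  move: we; rewrite eu !inE => /orP[] /eqP->; first by rewrite mu.
  by rewrite -{3}mu mK setUC.
apply/existsP; exists c; apply/forallP => e; apply/forallP => f; apply/implyP => /andP[ef dj].
apply: contra ef => /eqP ecf; case/pred0Pn: dj => w /andP[/= we wf]; apply/eqP/val_inj.
by rewrite (cE e w we) (cE f w wf) ecf.
Qed.

Lemma colorable_widen G k l : k <= l -> edge_colorable G k -> edge_colorable G l.
Proof.
move=> kl /existsP[c /forallP cP]; apply/existsP; exists [ffun e => widen_ord kl (c e)].
apply/forallP => e; apply/forallP => f; have /forallP/(_ f) := cP e.
by rewrite !ffunE -val_eqE /= val_eqE.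
Qed.

Lemma chromatic_colorable G k : chromatic_index G <= k -> edge_colorable G k.
Proof. by rewrite /chromatic_index; case: ex_minnP => l cl _ lk; apply: colorable_widen cl. Qed.

Lemma colorable_chromatic G k : edge_colorable G k -> chromatic_index G <= k.
Proof. by rewrite /chromatic_index; case: ex_minnP => l _ min; apply: min. Qed.

Lemma sum_degrees G : \sum_(v in vertices G) degree G v = 2 * #|edges G|.
Proof.
transitivity (\sum_(v in vertices G) \sum_(e in edges G) (v \in e : nat)).
  apply: eq_bigr => v _; rewrite /degree -sum1_card big_mkcond [RHS]big_mkcond.
  by apply: eq_bigr => e _; rewrite inE; case: (e \in edges G); case: (v \in e).
rewrite exchange_big /= mulnC -sum_nat_const; apply: eq_bigr => e eG.
have [/subsetP eV ce] := edge_sub eG; rewrite -[RHS]ce -[RHS]sum1_card big_mkcond [RHS]big_mkcond.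
by apply: eq_bigr => v _; have := eV v; case: (v \in e) => [->//|_]; case: ifP.
Qed.

Lemma degree_le_max G v : v \in vertices G -> degree G v <= max_degree G.
Proof. by move=> vG; rewrite /max_degree (bigD1 v) //= leq_maxl. Qed.

Lemma min_le_degree G v : v \in vertices G -> min_degree G <= degree G v.
Proof.
rewrite /min_degree; have := mem_index_enum v; elim: (index_enum _) => // u s IHs.
rewrite inE big_cons => /orP[/eqP <- -> |/IHs le vG]; first exact: geq_minl.
by case: ifP => _; rewrite ?geq_min le ?orbT.
Qed.

Lemma degree_le_order G v : degree G v <= graph_order G.
Proof.
rewrite -deg_degree; apply/subset_leq_card/subsetP => u; rewrite inE; exact: adj_vertex.
Qed.

Lemma ex_min_degree G v : v \in vertices G -> exists2 a, a \in vertices G & degree G a = min_degree G.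
Proof.
move=> vG; case: (arg_minnP (degree G) vG) => a aG amin; exists a => //; apply/eqP.
rewrite eqn_leq min_le_degree // andbT /min_degree.
(* The default value of the minimum does no harm, as no degree exceeds the order. *)
by elim/big_ind: _ => [|x y ax ay|u uG]; rewrite ?degree_le_order ?leq_min ?ax ?ay ?amin.
Qed.

End GraphColorings.

(** * Critical graphs are overfull under the degree bound *)

Section CriticalGraphs.

Variables (T : finType) (G : graph T).
Hypothesis critG : Delta_critical G.

Lemma critical_nocol (m : 'I_(max_degree G) -> T -> T) : ~ coloring (adj G) m.
Proof. by move=> /colorable_of/colorable_chromatic; rewrite critG.1 ltnn. Qed.

Lemma proper_coloring H : proper_subgraph H G ->
  exists m : 'I_(max_degree G) -> T -> T, coloring (adj H) m.
Proof.
by move/critG.2; rewrite critG.1 ltnS => /chromatic_colorable/coloring_of.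
Qed.

Lemma critical_edge x y : adj G x y ->
  exists m : 'I_(max_degree G) -> T -> T, coloring (minus (adj G) x y) m.
Proof.
move=> /andP[xy xyG].
have valid : [forall e in edges G :\ [set x; y], (e \subset vertices G) && (#|e| == 2)].
  apply/forallP => e; apply/implyP; rewrite inE => /andP[_ /edge_sub[-> ->]]; by [].
have [|m [Mm mR]] := @proper_coloring (Graph valid).
  rewrite /proper_subgraph /subgraph subxx subD1set /=; apply/orP; right.
  by apply/eqP => /setP/(_ [set x; y]); rewrite !inE eqxx xyG.
exists m; split=> // u v uv; rewrite mR // /minus /adj uv /= !inE andbC; congr (_ && ~~ _).
apply/eqP/idP => [e|/orP[] /andP[/eqP-> /eqP->] //]; last by rewrite setUC.
have : u \in [set x; y] by rewrite -e !inE eqxx.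
have : v \in [set x; y] by rewrite -e !inE eqxx orbT.
rewrite !inE /same_edge => /orP[] /eqP ev /orP[] /eqP eu; rewrite eu ev ?eqxx ?orbT //.
  by move: uv; rewrite eu ev eqxx.
by move: uv; rewrite eu ev eqxx.
Qed.

(** Deleting an isolated vertex does not change [adj], so the colouring of the smaller graph would
    be one of G. *)
Lemma critical_vertex v : v \in vertices G -> exists u, adj G v u.
Proof.
move=> vG; have [/existsP[u]|none] := boolP [exists u, adj G v u]; first by exists u.
exfalso; have nov e : e \in edges G -> v \notin e.
  move=> eG; apply/negP => ve; have [u uv eu] := edge_pair eG ve.
  by move: none; rewrite negb_exists => /forallP/(_ u); rewrite /adj eq_sym uv -eu eG.
have valid : [forall e in edges G, (e \subset vertices G :\ v) && (#|e| == 2)].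
  apply/forallP => e; apply/implyP => eG; have [s ->] := edge_sub eG.
  by rewrite subsetD1 s nov.
have [|m Cm] := @proper_coloring (Graph valid).
  rewrite /proper_subgraph /subgraph subD1set subxx /=; apply/orP; left.
  by apply/eqP => /setP/(_ v); rewrite !inE eqxx vG.
exact: critical_nocol Cm.
Qed.

Lemma critical_nonempty : exists v, v \in vertices G.
Proof.
apply/set0Pn/eqP => V0; apply: (critical_nocol (m := fun _ v => v)); split; first by split=> // p q u _ /eqP.
move=> u v uv; rewrite (introF existsP); last by case=> r; rewrite (negPf uv).
by apply/esym/negP => /adj_vertex; rewrite V0 inE.
Qed.

Lemma critical_overfull : 2 * graph_order G + 5 * min_degree G <= 3 * max_degree G + 12 -> overfull G.
Proof.
move=> large; have [v0 v0G] := critical_nonempty.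
have [a aG da] := ex_min_degree v0G; have [y ay] := critical_vertex aG.
pose C := 'I_(max_degree G).
have cC : #|C| = max_degree G by rewrite card_ord.
have dV v : v \in vertices G -> min_degree G <= deg (adj G) v <= #|C|.
  by move=> vG; rewrite deg_degree cC min_le_degree // degree_le_max.
have large' : 2 * #|vertices G| + 5 * min_degree G <= 3 * #|C| + 12 by rewrite cC.
have [b ab /andP[_ /eqP db]] :=
  ex_full_nbr (C := C) (@adj_sym _ G) (@adj_irr _ G) (@adj_vertex _ G) critical_nocol critical_edge dV ay.
have [oddV eV] := deficiency (@adj_sym _ G) (@adj_irr _ G) (@adj_vertex _ G) critical_nocol critical_edge
  dV ab (etrans (deg_degree G a) da) db large'.
move: eV; rewrite (eq_bigr (degree G)) => [|v _]; last exact: deg_degree.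
rewrite sum_degrees cC /overfull /graph_order => e.
have := odd_double_half #|vertices G|; rewrite oddV -mul2n => h.
(* With order 2h + 1 the count reads D + 2|E| = D(2h + 1) + 2, that is |E| = Dh + 1. *)
move: e; rewrite -{2}h; nia.
Qed.

End CriticalGraphs.

Theorem theorem1p3 (T : finType) (G : graph T) :
  Delta_critical G ->
  ((2%:R * (graph_order G)%:R + 5%:R * (min_degree G)%:R - 12%:R) / 3%:R
     <= (max_degree G)%:R :> rat)%R ->
  overfull G.
Proof.
move=> critG le; apply: critical_overfull => //.
(* The 12 is moved to the other side, so that the inequality can be read in [nat] without truncated
   subtraction. *)
rewrite Num.Theory.ler_pdivrMr // in le.
rewrite -(Num.Theory.ler_nat rat) GRing.natrD [leRHS]GRing.natrD.
rewrite (GRing.natrM _ 2) (GRing.natrM _ 5) (GRing.natrM _ 3).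
by rewrite -Num.Theory.lerBlDr [(3%:R * _)%R]GRing.mulrC.
Qed.
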